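(* Let $A>0$, $\gamma>1$, $\tau_\Pi>0$, $\zeta>0$ be constants, let $P(\rho)=A\rho^\gamma$ and $c_s^2=P'(\rho)$. Suppose that $(\rho,\mathbf v,\Pi)$ is a $C^1$ solution (with $\rho>0$) on $\mathbb R^3$ of $$\partial_t\rho+\partial_i(\rho v^i)=0,$$ $$\rho\,\partial_t v_i+\rho v^k\partial_k v_i+c_s^2\,\partial_i\rho+\partial_i\Pi=0\quad(i=1,2,3),$$ $$\tau_\Pi\,\partial_t\Pi+\tau_\Pi\,\partial_i(v^i\Pi)+\Pi+\zeta\,\partial_i v^i=0.$$ Suppose that $\rho(0,\mathbf x)=\rho^0(\mathbf x)>0$ for all $\mathbf x\in\mathbb R^3$, and that for some $R>0$ and some constant $\bar\rho>0$, $$\rho^0(\mathbf x)=\bar\rho,\qquad \mathbf v(0,\mathbf x)=0,\qquad \Pi(0,\mathbf x)=0\qquad\text{for } |\mathbf x|\ge R.$$ Set $$\bar c_v=\sqrt{A\gamma\bar\rho^{\,\gamma-1}+\frac{\zeta}{\bar\rho\,\tau_\Pi}},$$ $$\Delta M(t)=\int_{\mathbb R^3}(\rho-\bar\rho)\,d^3\mathbf x,\qquad F(t)=\int_{\mathbb R^3}x_i\,\rho\,v^i\,d^3\mathbf x,\qquad G(t)=\int_{\mathbb R^3}\Pi\,d^3\mathbf x .$$ Assume that $$\Delta M(0)\ge0,\qquad F(0)>\frac{16\pi}{3}\,\bar c_v\,R^4\,\max_{\mathbf x\in\mathbb R^3}\rho^0(\mathbf x),\qquad G(0)\ge0 .$$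 Then the lifespan of $(\rho,\mathbf v,\Pi)$ is finite.
   Context: Repeated indices are summed from $1$ to $3$; indices are raised and lowered with the Euclidean metric, so $v_i=v^i$. The unknowns $\rho$ (scalar), $\mathbf v=(v^1,v^2,v^3)$, $\Pi$ (scalar) are functions of $(t,\mathbf x)$ with $t\ge0$, $\mathbf x\in\mathbb R^3$. The lifespan is the supremum over all $\mathcal T>0$ such that the system admits a $C^1$ solution with the given initial data defined on $[0,\mathcal T]\times\mathbb R^3$. *)

(* Defs.v *)
From HB Require Import structures.
From mathcomp Require Import all_boot all_order all_algebra.
From mathcomp Require Import all_classical all_reals all_analysis.

Set Implicit Arguments.
Unset Strict Implicit.
Unset Printing Implicit Defensive.

Import Order.TTheory GRing.Theory Num.Theory.
Import numFieldNormedType.Exports.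

Local Open Scope classical_set_scope.
Local Open Scope ring_scope.

(* The library norm on 'rV[R]_3 is the sup norm (which induces the usual
   topology); |x| >= R refers to the Euclidean one. *)
Definition enorm (R : realType) (x : 'rV[R]_3) : R :=
  Num.sqrt (\sum_(i < 3) x 0 i ^+ 2).

Definition vec3 (R : realType) (p : R * R * R) : 'rV[R]_3 :=
  \row_(i < 3) [:: p.1.1; p.1.2; p.2]`_i.

(* Lebesgue integral over R^3, for the threefold product of the Lebesgue
   measure on the line, R^3 being identified with R * R * R by vec3. *)
Definition int3 (R : realType) (f : 'rV[R]_3 -> R) : R :=
  Rintegral ((@lebesgue_measure R \x @lebesgue_measure R)
               \x @lebesgue_measure R)%E setT (fun p => f (vec3 p)).

Definition dx (R : realType) (i : 'I_3) (f : 'rV[R]_3 -> R) (x : 'rV[R]_3) : R :=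
  'D_('e_i) f x.

(* Difference quotients in time taken within [0, T]: the derivative is
   one-sided at t = 0 and t = T and two-sided for 0 < t < T. *)
Definition tquot (R : realType) (T : R) (f : R -> 'rV[R]_3 -> R)
    (t : R) (x : 'rV[R]_3) : set_system R :=
  (fun h => h^-1 * (f (t + h) x - f t x))
    @ within [set h | 0 <= t + h <= T] (0 : R)^'.

Definition dt (R : realType) (T : R) (f : R -> 'rV[R]_3 -> R)
    (t : R) (x : 'rV[R]_3) : R :=
  lim (tquot T f t x).

Definition slab (R : realType) (T : R) : set (R * 'rV[R]_3) :=
  [set p | 0 <= p.1 <= T].

Definition cont_slab (R : realType) (T : R) (f : R -> 'rV[R]_3 -> R) : Prop :=
  {within slab T, continuous (fun p : R * 'rV[R]_3 => f p.1 p.2)}.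

Definition C1_slab (R : realType) (T : R) (f : R -> 'rV[R]_3 -> R) : Prop :=
  [/\ forall t x, 0 <= t <= T ->
        cvg (tquot T f t x) /\ forall i : 'I_3, derivable (f t) x 'e_i,
      cont_slab T f,
      cont_slab T (dt T f)
    & forall i : 'I_3, cont_slab T (fun t => dx i (f t))].

Definition pressure (R : realType) (A gamma r : R) : R := A * r `^ gamma.

Definition cs2 (R : realType) (A gamma r : R) : R := derive1 (pressure A gamma) r.

Definition is_C1_solution (R : realType) (A gamma tau zeta T : R)
    (rho : R -> 'rV[R]_3 -> R) (v : R -> 'rV[R]_3 -> 'rV[R]_3)
    (Pi : R -> 'rV[R]_3 -> R) : Prop :=
  [/\ C1_slab T rho,
      forall i : 'I_3, C1_slab T (fun t x => v t x 0 i),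
      C1_slab T Pi
    & forall t x, 0 <= t <= T ->
      [/\ 0 < rho t x,
          dt T rho t x
            + \sum_(i < 3) dx i (fun y => rho t y * v t y 0 i) x = 0,
          forall i : 'I_3,
            rho t x * dt T (fun s y => v s y 0 i) t x
            + rho t x * (\sum_(k < 3) v t x 0 k * dx k (fun y => v t y 0 i) x)
            + cs2 A gamma (rho t x) * dx i (rho t) x
            + dx i (Pi t) x = 0
        & tau * dt T Pi t x
            + tau * (\sum_(i < 3) dx i (fun y => v t y 0 i * Pi t y) x)
            + Pi t x
            + zeta * (\sum_(i < 3) dx i (fun y => v t y 0 i) x) = 0]].

Definition lifespan (R : realType) (A gamma tau zeta : R)
    (rho0 : 'rV[R]_3 -> R) (v0 : 'rV[R]_3 -> 'rV[R]_3)
    (Pi0 : 'rV[R]_3 -> R) : \bar R :=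
  ereal_sup [set T%:E | T in [set T : R | 0 < T /\
    exists rho v Pi, is_C1_solution A gamma tau zeta T rho v Pi /\
      forall x, [/\ rho 0 x = rho0 x, v 0 x = v0 x & Pi 0 x = Pi0 x]]].

Definition cvbar (R : realType) (A gamma tau zeta rhobar : R) : R :=
  Num.sqrt (A * gamma * rhobar `^ (gamma - 1) + zeta / (rhobar * tau)).

Definition DeltaM (R : realType) (rhobar : R) (rho : R -> 'rV[R]_3 -> R)
    (t : R) : R :=
  int3 (fun x => rho t x - rhobar).

Definition Fmom (R : realType) (rho : R -> 'rV[R]_3 -> R)
    (v : R -> 'rV[R]_3 -> 'rV[R]_3) (t : R) : R :=
  int3 (fun x => \sum_(i < 3) x 0 i * rho t x * v t x 0 i).

Definition Gint (R : realType) (Pi : R -> 'rV[R]_3 -> R) (t : R) : R :=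
  int3 (Pi t).

(* Main.v *)
(* Sideris-type virial argument.  In the constant-coefficient energy
     e = (rb |v|^2 + (p'(rb) / rb) (rho - rb)^2 + (tau / zeta) Pi^2) / 2
   the system is symmetric and its flux is bounded by c e, c = cvbar.  The
   nonlinear remainder is O(e) on compact sets, since the comparison solution
   is constant, so Gronwall on backward cones, with the weight
   max(0, (r - c t)^2 - |x - x0|^2)^2, confines the perturbation to the ball of
   radius r(t) = R0 + c t.
   Then mass is conserved, G(t) = exp(-t / tau) G(0) >= 0, and
     F' = int (rho |v|^2 + 3 (P - P(rb)) + 3 Pi) >= int rho |v|^2
   by convexity of P.  The Cauchy-Schwarz inequality on the ball, in the form
   rho |v - l x|^2 >= 0, gives F^2 <= (4 pi / 3) m r(t)^5 F' with m = max rho0.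
   Integrating F' / F^2 bounds r(T) as soon as F(0) exceeds the threshold. *)

Require Import Defs.
From HB Require Import structures.
From mathcomp Require Import all_boot all_order all_algebra.
From mathcomp Require Import all_classical all_reals all_analysis measurable_realfun.
From mathcomp Require Import ring lra.

Import Order.TTheory GRing.Theory Num.Theory.
Import numFieldNormedType.Exports.

Local Open Scope classical_set_scope.
Local Open Scope ring_scope.

Set Implicit Arguments.
Unset Strict Implicit.
Unset Printing Implicit Defensive.

(** * Integration over R^3 *)

(** Since the solution is only C^1, the energy is never differentiated twice: its coefficients are
    constant, and the first derivatives of the solution enter the remainder as bounded coefficients.
    The weight is the square of a positive part, hence C^1 on all of R^3 with compact support. Cone
    energy, mass, bulk integral and radial momentum are thereby all instances of one statement,
    [balance], on compactly supported fields over R^3, and no boundary of a moving ball occurs. The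
    speed c is that of the system linearised at rb: c^2 = P'(rb) + zeta / (rb tau). The factor m in
    the growth inequality does not come from a pointwise bound on the density at later times. It
    comes from mass: the ball of radius r(t) carries the mass Delta M(0) + rb vol(r(t)), and Delta
    M(0) <= (m - rb) vol(R0), so that this mass is at most m vol(r(t)). With a = 4 pi m / 3, the
    integral of 1 / (a (R0 + c t)^5) over t >= 0 is 1 / (4 a c R0^4), and 4 a c R0^4 is the
    threshold imposed on F(0). *)

Section int3_theory.
Variable R : realType.
Local Notation mu := (@lebesgue_measure R).
Local Notation mu2 := (mu \x mu)%E.
Local Notation mu3 := (mu2 \x mu)%E.
Local Notation RT := (measurableTypeR R).
Local Notation M3 := (RT * RT * RT)%type.
Local Notation V := 'rV[R]_3.

(** Second countability: an open set is a countable union of cubes with rational centre and radius,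
    each a measurable rectangle. *)
Lemma open_measurable3 (O : set (R * R * R)) : open O -> measurable (O : set M3).
Proof.
move=> oO.
pose B (q1 q2 q3 k : rat) : set (R * R * R) :=
  ((ball (ratr q1 : R) (ratr k)) `*` (ball (ratr q2 : R) (ratr k)))
  `*` ball (ratr q3 : R) (ratr k).
rewrite [X in measurable X](_ : (O : set M3) = \bigcup_q1 \bigcup_q2 \bigcup_q3
   \bigcup_(k in [set k | B q1 q2 q3 k `<=` O]) B q1 q2 q3 k); last first.
  apply/seteqP; split; last by move=> p [q1 _] [q2 _] [q3 _] [k /= + Bp]; exact.
  move=> [[a b] c] Op.
  have /nbhs_ballP[e /= e0 eO] : nbhs (a, b, c) O by apply: open_nbhs_nbhs.
  have [k] : exists k : rat, (ratr k : R) \in `]0, e / 2[.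
    by apply: rat_in_itvoo; rewrite divr_gt0.
  rewrite in_itv/= => /andP[k0 ke].
  have rq (x : R) : exists q : rat, ball (ratr q : R) (ratr k) x.
    have [|q] := @rat_in_itvoo R (x - ratr k) (x + ratr k).
      by lra.
    rewrite in_itv/= => /andP[h1 h2]; exists q.
    by rewrite /ball/= ltr_norml; apply/andP; split; lra.
  have [q1 h1] := rq a; have [q2 h2] := rq b; have [q3 h3] := rq c.
  exists q1 => //; exists q2 => //; exists q3 => //; exists k => //=.
  move=> [[x y] z] [] [] /= bx by_ bz.
  apply: eO; have ke' : ratr k + ratr k < e by lra.
  split=> /=; first split=> /=; apply: (le_ball (ltW ke'));
    apply: ball_triangle; try eassumption; exact: ball_sym.
do 3 apply: bigcupT_measurable_rat => ?.
rewrite bigcup_mkcond; apply: bigcupT_measurable_rat => k; case: ifP => // _.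
apply: measurableX; last exact: measurable_ball.
by apply: measurableX; exact: measurable_ball.
Qed.

Lemma continuous_measurable3 (g : R * R * R -> R) :
  continuous g -> measurable_fun setT (g : M3 -> R).
Proof.
move=> /continuousP cg; apply: (measurability _ (RGenOpens.measurableE R)) => //.
move=> _ [_ [a [b ->] <-]]; rewrite setTI.
apply: open_measurable3; apply: cg; exact: interval_open.
Qed.

Lemma vec3_continuous : continuous (@vec3 R).
Proof.
move=> [[a b] c]; apply/cvg_ballP => e e0.
have hb := nbhsx_ballx ((a, b, c) : R * R * R) e e0.
near=> p => /=; split => [//|i j]; rewrite /vec3 !mxE.
suff [[h1 h2] h3] : ball (a, b, c) e p.
  by case: j => -[|[|[|//]]] hj /=.
near: p; exact: hb.
Unshelve. all: by end_near. Qed.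

(** The norm is the sup norm, so the support lies in a cube, the shape suited to Fubini. Euclidean
    balls enter through [enorm] and [sqnorm]. *)
Definition csupp (L : R) (f : V -> R) := forall x : V, L <= `|x| -> f x = 0.

Lemma norm_vec3_ge (p : R * R * R) (i : 'I_3) : `|vec3 p 0 i| <= `|vec3 p|.
Proof. by rewrite [leRHS]mx_normrE; exact: (le_bigmax _ _ (0, i)). Qed.

Let box (L : R) : set M3 :=
  (`[-L, L] `*` `[-L, L]) `*` `[-L, L].

Let mbox L : measurable (box L).
Proof. by apply: measurableX => //; exact: measurableX. Qed.

Let box_fin L : (mu3 (box L) < +oo)%E.
Proof.
have hI : (mu [set` `[(-L)%R, L%R]] < +oo)%E.
  by rewrite lebesgue_measure_itv/=; case: ifP => _ //; rewrite -EFinB ltry.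
have hfin : mu [set` `[-L, L]] \is a fin_num by rewrite ge0_fin_numE.
rewrite product_measure1E//; last exact: measurableX.
rewrite [X in (X * _)%E]product_measure1E//.
by rewrite -ge0_fin_numE ?fin_numM// ?mule_ge0.
Qed.

Lemma compact_norm_le (L : R) : compact [set x : V | `|x| <= L].
Proof.
apply: bounded_closed_compact.
  by exists L; split; [exact: num_real|move=> M LM x /= xL; exact: (le_trans xL (ltW LM))].
rewrite [X in closed X](_ : _ = (fun x : V => `|x|) @^-1` [set r : R | r <= L])//.
by apply: closed_comp; [move=> ? _; exact: norm_continuous|exact: closed_le].
Qed.

Lemma csupp_bounded L (f : V -> R) : continuous f -> csupp L f ->
  exists2 M, 0 <= M & forall x, `|f x| <= M.
Proof.
move=> cf sf.
have /compact_bounded[M [_ hM]] := continuous_compact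
  (continuous_subspaceT cf) (@compact_norm_le L).
exists (`|M| + 1) => // x.
have [xL|Lx] := leP (`|x|) L; last by rewrite sf ?ltW// normr0.
by apply: (hM (`|M| + 1)); [rewrite (le_lt_trans (ler_norm _))// ltrDl|exists x].
Qed.

Lemma csupp_integrable L (f : V -> R) : continuous f -> csupp L f ->
  mu3.-integrable setT (EFin \o (fun p : M3 => f (vec3 p))).
Proof.
move=> cf sf.
have [M M0 hM] := csupp_bounded cf sf.
have cg : continuous (fun p => f (vec3 p)).
  by move=> p; apply: continuous_comp; [exact: vec3_continuous|exact: cf].
have -> : (fun p : M3 => f (vec3 p)) = (fun p : M3 => f (vec3 p)) \_ (box L).
  apply/funext => p; rewrite patchE; case: ifPn => // /negP pL.
  apply: sf; rewrite leNgt; apply/negP => Lp; apply: pL; rewrite inE.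
  have h i : `|vec3 p 0 i| <= L by rewrite (le_trans (norm_vec3_ge p i))// ltW.
  by move: (h 0) (h 1) (h 2%:R); rewrite !mxE/= => *; split; [split|]; rewrite /= in_itv/= -ler_norml.
rewrite -restrict_EFin; apply: (iffLR (integrable_mkcond _ _)) => //.
apply: measurable_bounded_integrable => //.
- exact: box_fin.
- apply: measurable_funTS; exact: continuous_measurable3.
- by exists M; split; [exact: num_real|move=> x Mx y _; exact: (le_trans (hM _) (ltW Mx))].
Qed.

End int3_theory.

(** * Fubini on R^3 and the integral of a partial derivative *)

Section int3_derivative.
Variable R : realType.
Local Notation mu := (@lebesgue_measure R).
Local Notation mu2 := (mu \x mu)%E.
Local Notation mu3 := (mu2 \x mu)%E.
Local Notation RT := (measurableTypeR R).
Local Notation M2 := (RT * RT)%type.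
Local Notation M3 := (RT * RT * RT)%type.
Local Notation V := 'rV[R]_3.

Definition int3able (f : V -> R) :=
  mu3.-integrable setT (EFin \o (fun p : M3 => f (vec3 p))).

Lemma csupp_int3able L (f : V -> R) : continuous f -> csupp L f -> int3able f.
Proof. exact: csupp_integrable. Qed.

Lemma int3D (f g : V -> R) : int3able f -> int3able g ->
  int3 (fun x => f x + g x) = int3 f + int3 g.
Proof. by move=> If Ig; rewrite /int3 -RintegralD. Qed.

Lemma int3Z (c : R) (f : V -> R) : int3able f ->
  int3 (fun x => c * f x) = c * int3 f.
Proof. by move=> If; rewrite /int3 -RintegralZl. Qed.

Lemma int3ableD (f g : V -> R) : int3able f -> int3able g ->
  int3able (fun x => f x + g x).
Proof. by move=> If Ig; exact: (integrableD measurableT If Ig). Qed.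

Lemma int3ableZ c (f : V -> R) : int3able f -> int3able (fun x => c * f x).
Proof. by move=> If; exact: (integrableZl measurableT c If). Qed.

Lemma le_int3 (f g : V -> R) : int3able f -> int3able g ->
  (forall x, f x <= g x) -> int3 f <= int3 g.
Proof. by move=> If Ig fg; apply: le_Rintegral => // p _; exact: fg. Qed.

Lemma int3_ge0 (f : V -> R) : (forall x, 0 <= f x) -> 0 <= int3 f.
Proof. by move=> f0; apply: Rintegral_ge0. Qed.

Lemma int3_0 : int3 (fun _ : V => 0 : R) = 0.
Proof. by rewrite /int3 /Rintegral integral0. Qed.

Lemma integral_derivative_eq0 L (h h' : R -> R) : continuous h' ->
  (forall x : R, is_derive x 1 h (h' x)) ->
  (forall x, L <= `|x| -> h x = 0) -> (forall x, L <= `|x| -> h' x = 0) ->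
  (\int[mu]_x (h' x)%:E = 0)%E.
Proof.
move=> ch' dh hL h'L.
(* No sign of [L] is assumed; this choice keeps the interval nondegenerate. *)
pose a := `|L| + 1; have a0 : 0 < a by rewrite ltr_pwDr.
have La : L <= a by rewrite (le_trans (ler_norm _))// lerDl.
have ch : continuous h by move=> x; apply: differentiable_continuous; apply/derivable1_diffP; have [] := dh x.
rewrite (_ : (fun x => (h' x)%:E) = (fun x => (h' x)%:E) \_ `[- a, a]); last first.
  apply/funext => x; rewrite patchE; case: ifPn => // /negP xa.
  rewrite h'L// (le_trans La)// leNgt; apply/negP => xa'; apply: xa.
  by rewrite inE/= in_itv/= -ler_norml ltW.
rewrite -integral_mkcond (@continuous_FTC2 _ _ h).
- by rewrite !hL ?subee// ?normrN (le_trans La)// ler_norm.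
- by rewrite gtrN.
- exact: continuous_subspaceT.
- split; [by move=> x _; have [] := dh x| |].
  + exact: cvg_at_right_filter (ch _).
  + exact: cvg_at_left_filter (ch _).
- by move=> x _; rewrite derive1E; have [_ ->] := dh x.
Qed.

Lemma csupp_integrable2 L (f : V -> R) z : continuous f -> csupp L f ->
  mu2.-integrable setT (EFin \o (fun p : M2 => f (vec3 (p, z)))).
Proof.
move=> cf sf; have [M M0 hM] := csupp_bounded cf sf.
have cg : continuous (fun p => f (vec3 p)).
  by move=> p; apply: continuous_comp; [exact: vec3_continuous|exact: cf].
pose box : set M2 := `[-L, L] `*` `[-L, L].
have mbox : measurable box by apply: measurableX.
have -> : (fun p : M2 => f (vec3 (p, z))) = (fun p : M2 => f (vec3 (p, z))) \_ box.
  apply/funext => p; rewrite patchE; case: ifPn => // /negP pL.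
  apply: sf; rewrite leNgt; apply/negP => Lp; apply: pL; rewrite inE.
  have h i : `|vec3 (p, z) 0 i| <= L by rewrite (le_trans (norm_vec3_ge (p, z) i))// ltW.
  by move: (h 0) (h 1); rewrite !mxE/= => *; split; rewrite /= in_itv/= -ler_norml.
rewrite -restrict_EFin; apply: (iffLR (integrable_mkcond _ _)) => //.
apply: measurable_bounded_integrable => //.
- suff : (mu2 box < +oo)%E by [].
  have hI : (mu [set` `[(-L)%R, L%R]] < +oo)%E.
    by rewrite lebesgue_measure_itv/=; case: ifP => _ //; rewrite -EFinB ltry.
  have hfin : mu [set` `[-L, L]] \is a fin_num by rewrite ge0_fin_numE.
  rewrite /box product_measure1E//.
  by rewrite -ge0_fin_numE ?fin_numM// ?mule_ge0.
- apply: measurable_funTS.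
  apply: (measurableT_comp (f := fun p : M3 => f (vec3 p)) (g := fun p : M2 => (p, z))).
    exact: continuous_measurable3.
  exact: measurable_fun_pair.
- by exists M; split; [exact: num_real|move=> x Mx y _; exact: (le_trans (hM _) (ltW Mx))].
Qed.


Let smu : {sigma_finite_measure set RT -> \bar R} := mu.
Lemma mu2_sigma_finite : sigma_finite setT mu2.
Proof.
have cover (x : R) : exists n : nat, forall m, (n <= m)%N -> x \in `[- m%:R, m%:R].
  exists (Num.truncn `|x|).+1 => m nm; rewrite in_itv/= -ler_norml.
  by rewrite (le_trans (ltW (truncnS_gt _)))// ler_nat.
exists (fun n : nat => `[- n%:R, n%:R] `*` `[- n%:R, n%:R]).
  apply/esym/seteqP; split => // -[x y] _.
  have [n hn] := cover x; have [m hm] := cover y.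
  by exists (maxn n m) => //; split; [apply: hn; rewrite leq_maxl|apply: hm; rewrite leq_maxr].
move=> n; split; first exact: measurableX.
have hI : (mu [set` `[(- n%:R)%R, n%:R%R]] < +oo)%E.
  by rewrite lebesgue_measure_itv/=; case: ifP => _ //; rewrite -EFinB ltry.
have hfin : mu [set` `[- n%:R, n%:R]] \is a fin_num by rewrite ge0_fin_numE.
rewrite product_measure1E//.
by rewrite -ge0_fin_numE ?fin_numM// ?mule_ge0.
Qed.
Let pmu : {measure set M2 -> \bar R} := (smu \x smu)%E.

(* The library registers a sigma-finite instance on products of
   subprobabilities only, hence this explicit one. *)
Let smu2 : {sigma_finite_measure set M2 -> \bar R} :=
  HB.pack (Measure.sort pmu) (Measure_isSigmaFinite.Build _ _ _ pmu mu2_sigma_finite).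

Lemma integral_mu3_z (g : M3 -> R) : mu3.-integrable setT (EFin \o g) ->
  (\int[mu3]_p (g p)%:E = \int[mu]_z \int[mu2]_p (g (p, z))%:E)%E.
Proof. by move=> Ig; apply/esym; exact: (@integral21_prod_meas1 _ _ _ _ _ smu2 smu _ Ig). Qed.

Lemma integral_mu3_p (g : M3 -> R) : mu3.-integrable setT (EFin \o g) ->
  (\int[mu3]_p (g p)%:E = \int[mu2]_p \int[mu]_z (g (p, z))%:E)%E.
Proof. by move=> Ig; apply/esym; exact: (@integral12_prod_meas1 _ _ _ _ _ smu2 smu _ Ig). Qed.

Lemma integral_mu2_y (g : M2 -> R) : mu2.-integrable setT (EFin \o g) ->
  (\int[mu2]_p (g p)%:E = \int[mu]_y \int[mu]_x (g (x, y))%:E)%E.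
Proof. by move=> Ig; apply/esym; exact: (@integral21_prod_meas1 _ _ _ _ _ smu smu _ Ig). Qed.

Lemma integral_mu2_x (g : M2 -> R) : mu2.-integrable setT (EFin \o g) ->
  (\int[mu2]_p (g p)%:E = \int[mu]_x \int[mu]_y (g (x, y))%:E)%E.
Proof. by move=> Ig; apply/esym; exact: (@integral12_prod_meas1 _ _ _ _ _ smu smu _ Ig). Qed.

Lemma integral_mu3_tonelli (g : M3 -> R) :
  measurable_fun setT g -> (forall p, 0 <= g p) ->
  (\int[mu3]_p (g p)%:E = \int[mu]_z \int[mu]_y \int[mu]_x (g (x, y, z))%:E)%E.
Proof.
move=> mg g0.
have h1 : measurable_fun setT (EFin \o g) by exact/measurable_EFinP.
have h2 p : (0 <= (EFin \o g) p)%E by rewrite lee_fin.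
transitivity (\int[smu]_z fubini_G smu2 (EFin \o g) z)%E.
  exact: (@fubini_tonelli2 _ _ _ _ _ smu2 smu _ h1 h2).
apply: eq_integral => z _; rewrite /fubini_G.
have h3 : measurable_fun setT (fun p => (EFin \o g) (p, z)).
  by apply: (measurableT_comp h1); exact: measurable_fun_pair.
exact: (@fubini_tonelli2 _ _ _ _ _ smu smu _ h3 (fun p => h2 _)).
Qed.

(** By Fubini it suffices to integrate along the lines parallel to the i-th axis, where the
    fundamental theorem of calculus applies. *)
Lemma int3_derivative L (f g : V -> R) (i : 'I_3) : continuous g ->
  csupp L f -> csupp L g -> (forall x, is_derive x 'e_i f (g x)) ->
  int3 g = 0.
Proof.
move=> cg sf sg df.
have Ig := csupp_integrable cg sg.
have cgv : continuous (fun p => g (vec3 p)).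
  by move=> p; apply: continuous_comp; [exact: vec3_continuous|exact: cg].
(* [k] parametrises a line in direction ['e_i]; its second property carries the compact support over
   to the line. *)
have line (k : R -> V) : (forall y h, k (h + y) = h *: 'e_i + k y) ->
    (forall y, `|y| <= `|k y|) -> (\int[mu]_y (g (k y))%:E = 0)%E.
  move=> kD kn.
  have ck : continuous k.
    have -> : k = (fun y => y *: 'e_i + k 0) by apply/funext => y; rewrite -kD addr0.
    by move=> y; apply: cvgD; [exact: scalel_continuous|exact: cvg_cst].
  apply: (@integral_derivative_eq0 L (f \o k)).
  - by move=> y; apply: continuous_comp; [exact: ck|exact: cg].
  - move=> y; have [h1 h2] := df (k y).
    have e : (fun h : R => h^-1 *: (((f \o k) \o shift y) (h *: 1) - (f \o k) y)) =
             (fun h : R => h^-1 *: ((f \o shift (k y)) (h *: 'e_i) - f (k y))).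
      by apply/funext => h; rewrite /= [h *: 1]mulr1 kD.
    by split; [rewrite /derivable e|rewrite /derive e].
  - by move=> y Ly; apply: sf; apply: le_trans (kn y).
  - by move=> y Ly; apply: sg; apply: le_trans (kn y).
rewrite /int3 /Rintegral.
suff -> : (\int[mu3]_p (g (vec3 p))%:E = 0)%E by [].
(* In each case the order of integration makes the i-th variable the innermost one. *)
case: i df line => -[|[|[|//]]] ilt df line.
- rewrite (integral_mu3_z Ig).
  rewrite (eq_integral (fun=> 0%E)) ?integral0// => z _.
  rewrite (integral_mu2_y (csupp_integrable2 z cg sg)).
  rewrite (eq_integral (fun=> 0%E)) ?integral0// => y _.
  apply: (line (fun x => vec3 (x, y, z))).
    move=> x h; apply/rowP => -[[|[|[|//]]] jlt]; rewrite !mxE/= ?mulr1 ?mulr0 ?add0r//.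
  by move=> x; have := norm_vec3_ge (x, y, z) 0; rewrite mxE.
- rewrite (integral_mu3_z Ig).
  rewrite (eq_integral (fun=> 0%E)) ?integral0// => z _.
  rewrite (integral_mu2_x (csupp_integrable2 z cg sg)).
  rewrite (eq_integral (fun=> 0%E)) ?integral0// => x _.
  apply: (line (fun y => vec3 (x, y, z))).
    move=> y h; apply/rowP => -[[|[|[|//]]] jlt]; rewrite !mxE/= ?mulr1 ?mulr0 ?add0r//.
  by move=> y; have := norm_vec3_ge (x, y, z) 1; rewrite mxE.
- rewrite (integral_mu3_p Ig).
  rewrite (eq_integral (fun=> 0%E)) ?integral0// => p _.
  apply: (line (fun z => vec3 (p, z))).
    move=> y h; apply/rowP => -[[|[|[|//]]] jlt]; rewrite !mxE/= ?mulr1 ?mulr0 ?add0r//.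
  by move=> z; have := norm_vec3_ge (p, z) 2%:R; rewrite mxE.
Qed.

End int3_derivative.

(** * Volume of the Euclidean ball *)

Section ball_volume.
Variable R : realType.
Local Notation mu := (@lebesgue_measure R).
Local Notation mu2 := (mu \x mu)%E.
Local Notation mu3 := (mu2 \x mu)%E.
Local Notation RT := (measurableTypeR R).
Local Notation M2 := (RT * RT)%type.
Local Notation M3 := (RT * RT * RT)%type.
Local Notation V := 'rV[R]_3.

(** The derivative of [asin] blows up at the endpoints, so continuity there is obtained by viewing
    the function as the inverse of [a * sin t] on a segment. The fundamental theorem of calculus
    needs these endpoint limits. *)
Lemma within_continuous_asin_div (a : R) : 0 < a ->
  {within `[(- a), a], continuous (fun y => asin (y / a))}.
Proof.
move=> a0; have an0 : a != 0 by rewrite gt_eqF.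
have p0 : 0 <= pi :> R by exact: pi_ge0.
have -> : `[- a, a] = `[a * sin (- (pi / 2)), a * sin (pi / 2)].
  by rewrite sinN sin_pihalf mulrN mulr1.
apply: (@segment_can_le_continuous _ _ _ (fun t => a * sin t)); first by lra.
- apply: continuous_subspaceT => x.
  by apply: cvgM; [exact: cvg_cst|exact: continuous_sin].
- by move=> x xp; rewrite mulrC mulKf// sinK.
Qed.

Lemma integral_half_disc (a : R) : 0 < a ->
  (\int[mu]_(y in `[(- a)%R, a]) (Num.sqrt (a ^+ 2 - y ^+ 2))%:E
   = (pi * a ^+ 2 / 2)%:E)%E.
Proof.
move=> a0; have an0 : a != 0 by rewrite gt_eqF.
have cq : continuous (fun y : R => a ^+ 2 - y ^+ 2).
  by move=> y; apply: cvgB; [exact: cvg_cst|exact: exprn_continuous].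
have cs : continuous (fun y : R => Num.sqrt (a ^+ 2 - y ^+ 2)).
  by move=> y; apply: (@continuous_comp _ _ _ (fun y : R => a ^+ 2 - y ^+ 2)); [exact: cq|exact: sqrt_continuous].
(* The antiderivative given by the substitution y = a sin t. *)
pose F (y : R) := (y * Num.sqrt (a ^+ 2 - y ^+ 2) + a ^+ 2 * asin (y / a)) / 2.
have dF y : y \in `]-a, a[ -> is_derive y 1 F (Num.sqrt (a ^+ 2 - y ^+ 2)).
  rewrite in_itv/= => /andP[ya1 ya2].
  have ay : 0 < a ^+ 2 - y ^+ 2.
    by rewrite subr_sqr mulr_gt0; lra.
  have h1 : -1 < y / a < 1.
    by rewrite ltr_pdivlMr// ltr_pdivrMr// mulN1r mul1r ya1 ya2.
  have d1 : is_derive (y / a) 1 (@asin R) (Num.sqrt (1 - (y / a) ^+ 2))^-1 by exact: is_derive1_asin.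
  have d2 := is_derive1_sqrt ay.
  have e : Num.sqrt (1 - (y / a) ^+ 2) = Num.sqrt (a ^+ 2 - y ^+ 2) / a.
    have -> : 1 - (y / a) ^+ 2 = (a ^+ 2 - y ^+ 2) / a ^+ 2 by field.
    by rewrite sqrtrM ?ltW// sqrtrV ?exprn_ge0 ?ltW// sqrtr_sqr gtr0_norm.
  have s0 : 0 < Num.sqrt (a ^+ 2 - y ^+ 2) by rewrite sqrtr_gt0.
  have sq : a ^+ 2 - y ^+ 2 = Num.sqrt (a ^+ 2 - y ^+ 2) ^+ 2 by rewrite sqr_sqrtr// ltW.
  have d3 : is_derive y 1 (fun y : R => y / a) a^-1.
    by apply: is_derive_eq; rewrite ?mul1r ?mulr0 ?addr0 ?scaler0 ?add0r ?/GRing.scale/= ?mulr1.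
  have d4 : is_derive y 1 (fun y : R => asin (y / a)) ((Num.sqrt (1 - (y / a) ^+ 2))^-1 * a^-1).
    exact: (@is_derive1_comp _ _ (fun y : R => y / a)).
  have d5 : is_derive y 1 (fun y : R => Num.sqrt (a ^+ 2 - y ^+ 2))
     ((2 * Num.sqrt (a ^+ 2 - y ^+ 2))^-1 * (- (2 * y))).
    apply: (@is_derive1_comp _ _ (fun y : R => a ^+ 2 - y ^+ 2)).
    by apply: is_derive_eq; rewrite /GRing.scale/=; ring.
  apply: is_derive_eq; rewrite !scaler0 add0r /GRing.scale/= e mulr1.
  set S := Num.sqrt _ in s0 sq *.
  have Sn0 : S != 0 by rewrite gt_eqF.
  have -> : a ^+ 2 * ((S / a)^-1 / a) = (S ^+ 2 + y ^+ 2) / S by rewrite -sq; field; rewrite Sn0.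
  by field.
have e1 : asin (1 : R) = pi / 2.
  by have := @sinK R (pi / 2); rewrite sin_pihalf; apply; rewrite in_itv/= lexx andbT; have := pi_ge0 R; lra.
have e2 : asin (-1 : R) = - (pi / 2).
  by have := @sinK R (- (pi / 2)); rewrite sinN sin_pihalf; apply; rewrite in_itv/= lexx /=; have := pi_ge0 R; lra.
have aa : - a < a by rewrite gtrN.
rewrite (@continuous_FTC2 _ _ F) => //.
- rewrite /F sqrrN subrr sqrtr0 !mulr0 !add0r mulNr divff// e1 e2 -EFinB.
  by congr (_%:E); field.
- exact: continuous_subspaceT.
- have [_ gl gr] := (continuous_within_itvP _ aa).1 (within_continuous_asin_div a0).
  split; first by move=> y ya; have [] := dF y ya.
  + apply: cvgM; last exact: cvg_cst.
    apply: cvgD; first apply: cvgM.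
    * exact: (cvg_at_right_filter (@cvg_id _ _)).
    * exact: (cvg_at_right_filter (cs _)).
    * by apply: cvgM; [exact: cvg_cst|exact: gl].
  + apply: cvgM; last exact: cvg_cst.
    apply: cvgD; first apply: cvgM.
    * exact: (cvg_at_left_filter (@cvg_id _ _)).
    * exact: (cvg_at_left_filter (cs _)).
    * by apply: cvgM; [exact: cvg_cst|exact: gr].
- by move=> y ya; rewrite derive1E; have [_ ->] := dF y ya.
Qed.

(** With s = r^2 - z^2 this is the area of the section of a ball at height z. [Num.sqrt] is 0 on
    negative reals, which accounts for the planes and lines that miss the ball. *)
Lemma integral_disc (s : R) :
  (\int[mu]_y (2 * Num.sqrt (s - y ^+ 2))%:E = (pi * Num.max 0 s)%:E)%E.
Proof.
have [s0|s0] := leP s 0.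
  rewrite (eq_integral (fun=> 0%E)) ?integral0 ?mulr0// => y _.
  by rewrite ler0_sqrtr ?mulr0//; have := sqr_ge0 y; lra.
have a0 : 0 < Num.sqrt s by rewrite sqrtr_gt0.
set a := Num.sqrt s in a0.
have sa : s = a ^+ 2 by rewrite sqr_sqrtr ?ltW.
have -> : (fun y => (2 * Num.sqrt (s - y ^+ 2))%:E) =
    (fun y : R => (2 * Num.sqrt (a ^+ 2 - y ^+ 2))%:E) \_ `[- a, a].
  apply/funext => y; rewrite patchE -sa; case: ifPn => // /negP ya.
  rewrite ler0_sqrtr ?mulr0// subr_le0 sa leNgt; apply/negP => ya'.
  apply: ya; rewrite inE/= in_itv/= -ler_norml.
  rewrite -(@ler_pXn2r _ 2) ?nnegrE// ?real_normK ?num_real//; exact: ltW.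
have cs : {within `[- a, a], continuous (fun y : R => Num.sqrt (a ^+ 2 - y ^+ 2))}.
  apply: continuous_subspaceT => y.
  apply: (@continuous_comp _ _ _ (fun y : R => a ^+ 2 - y ^+ 2)); last exact: sqrt_continuous.
  by apply: cvgB; [exact: cvg_cst|exact: exprn_continuous].
rewrite -integral_mkcond.
under eq_integral do rewrite EFinM.
rewrite integralZl//=; last first.
  by apply: continuous_compact_integrable => //; exact: segment_compact.
by rewrite integral_half_disc// -EFinM sa; congr (_%:E); field.
Qed.

Lemma integral_chord (s : R) :
  (\int[mu]_x ((x ^+ 2 <= s)%R%:R)%:E = (2 * Num.sqrt s)%:E :> \bar R)%E.
Proof.
have [s0|s0] := ltP s 0.
  rewrite (eq_integral (fun=> 0%E)) ?integral0 ?ler0_sqrtr ?mulr0 ?ltW// => x _.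
  by rewrite leNgt (lt_le_trans s0 (sqr_ge0 x)).
set a := Num.sqrt s.
have a0 : 0 <= a by rewrite sqrtr_ge0.
have sa : s = a ^+ 2 by rewrite sqr_sqrtr.
rewrite (eq_integral (fun x : RT => (\1_([set` `[- a, a]] : set RT) x)%:E)); last first.
  move=> x _; rewrite indicE sa -(real_normK (num_real x)) ler_pXn2r ?nnegrE//.
  by congr (_%:R%:E); rewrite mem_setE in_itv/= -ler_norml.
rewrite integral_indic// setIT.
transitivity (mu [set` `[- a, a]]) => //; rewrite lebesgue_measure_itv/= lte_fin.
case: ltP => h; first by rewrite -EFinB; congr (_%:E); lra.
by congr (_%:E); lra.
Qed.

Lemma integral_ball_profile (r : R) : 0 < r ->
  (\int[mu]_z (pi * Num.max 0 (r ^+ 2 - z ^+ 2))%:E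
   = (4 / 3 * pi * r ^+ 3)%:E)%E.
Proof.
move=> r0.
have -> : (fun z => (pi * Num.max 0 (r ^+ 2 - z ^+ 2))%:E) =
    (fun z : R => (pi * (r ^+ 2 - z ^+ 2))%:E) \_ `[- r, r].
  apply/funext => z; rewrite patchE mem_setE in_itv/= -ler_norml.
  have -> : (`|z| <= r) = (z ^+ 2 <= r ^+ 2).
    by rewrite -(real_normK (num_real z)) ler_pXn2r// nnegrE ltW.
  case: (leP (z ^+ 2) (r ^+ 2)) => h.
    by have /max_idPr -> : 0 <= r ^+ 2 - z ^+ 2 by lra.
  have /max_idPl -> : r ^+ 2 - z ^+ 2 <= 0 by lra.
  by rewrite mulr0.
pose F (z : R) := pi * (r ^+ 2 * z - z ^+ 3 / 3).
have dF (z : R) : is_derive z 1 F (pi * (r ^+ 2 - z ^+ 2)).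
  by apply: is_derive_eq; rewrite /GRing.scale/=; field.
have cf : continuous (fun z : R => pi * (r ^+ 2 - z ^+ 2)).
  by move=> z; apply: cvgM; [exact: cvg_cst|apply: cvgB; [exact: cvg_cst|exact: exprn_continuous]].
have cF : continuous F by move=> z; apply: differentiable_continuous; apply/derivable1_diffP; have [] := dF z.
rewrite -integral_mkcond (@continuous_FTC2 _ _ F).
- by rewrite /F -EFinB; congr (_%:E); field.
- by rewrite gtrN.
- exact: continuous_subspaceT.
- split; [by move=> x _; have [] := dF x| |].
  + exact: cvg_at_right_filter (cF _).
  + exact: cvg_at_left_filter (cF _).
- by move=> x _; rewrite derive1E; have [_ ->] := dF x.
Qed.

Definition sqnorm (x : V) : R := \sum_(i < 3) x 0 i ^+ 2.

Definition ball_ind (r : R) (x : V) : R := (sqnorm x <= r ^+ 2)%R%:R.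

Lemma sum3 (F : 'I_3 -> R) : \sum_(i < 3) F i = F 0 + F 1 + F 2%:R.
Proof.
rewrite !big_ord_recr big_ord0/= add0r.
by congr (F _ + F _ + F _); exact/val_inj.
Qed.

Lemma sqnorm_continuous : continuous sqnorm.
Proof.
have -> : sqnorm = (fun x : V => x 0 0 ^+ 2 + x 0 1 ^+ 2 + x 0 2%:R ^+ 2).
  by apply/funext => x; exact: sum3.
have h i : continuous (fun x : V => x 0 i ^+ 2).
  by move=> x; apply: (@continuous_comp _ _ _ (fun x : V => x 0 i) (fun y : R => y ^+ 2)); [exact: coord_continuous|exact: exprn_continuous].
by move=> x; exact: (cvgD (cvgD (h 0 x) (h 1 x)) (h 2%:R x)).
Qed.

Lemma sqnorm_vec3 (p : R * R * R) : sqnorm (vec3 p) = p.1.1 ^+ 2 + p.1.2 ^+ 2 + p.2 ^+ 2.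
Proof. by rewrite /sqnorm sum3 !mxE. Qed.

(** Slicing into discs and chords. Tonelli gives the value first, and integrability is read off from
    its finiteness. *)
Lemma ball_volume (r : R) : 0 < r ->
  int3able (ball_ind r) /\ int3 (ball_ind r) = 4 / 3 * pi * r ^+ 3.
Proof.
move=> r0.
have mB : measurable_fun setT (fun p : M3 => ball_ind r (vec3 p)).
  have cq : continuous (fun p => sqnorm (vec3 p)).
    by move=> p; apply: continuous_comp; [exact: vec3_continuous|exact: sqnorm_continuous].
  pose B : set M3 := (fun p : M3 => sqnorm (vec3 p)) @^-1` `]-oo, r ^+ 2].
  have mB : measurable B.
    rewrite -[B]setTI; apply: (continuous_measurable3 cq) => //.
  rewrite [X in measurable_fun _ X](_ : _ = \1_B); first exact: measurable_indic.
  by apply/funext => p; rewrite indicE /ball_ind; congr (nat_of_bool _)%:R; apply/idP/idP; rewrite inE.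
have I : (\int[mu3]_p (ball_ind r (vec3 p))%:E = (4 / 3 * pi * r ^+ 3)%:E)%E.
  rewrite (integral_mu3_tonelli mB (fun p => ler0n _ _)).
  rewrite -integral_ball_profile//; apply: eq_integral => z _.
  rewrite -integral_disc; apply: eq_integral => y _.
  rewrite -integral_chord; apply: eq_integral => x _.
  rewrite /ball_ind sqnorm_vec3/=; congr ((nat_of_bool _)%:R%:E).
  by apply/idP/idP => ?; lra.
split; last by rewrite /int3 /Rintegral I.
apply/integrableP; split; first exact/measurable_EFinP.
under eq_integral do rewrite gee0_abs ?lee_fin ?ler0n//.
by rewrite I ltry.
Qed.

End ball_volume.
(** * Fields on a slab and balance laws *)

Section slab_fields.
Variable R : realType.
Local Notation mu := (@lebesgue_measure R).
Local Notation mu2 := (mu \x mu)%E.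
Local Notation mu3 := (mu2 \x mu)%E.
Local Notation RT := (measurableTypeR R).
Local Notation M3 := (RT * RT * RT)%type.
Local Notation V := 'rV[R]_3.

(** If f x > 0, then f exceeds f x / 2 on a cube of positive measure, against Markov's inequality at
    that level. *)
Lemma int3_eq0 L (f : V -> R) : continuous f -> csupp L f ->
  (forall x, 0 <= f x) -> int3 f = 0 -> forall x, f x = 0.
Proof.
move=> cf sf f0 If x; apply/eqP; rewrite eq_le f0 andbT leNgt; apply/negP => fx.
have If' := csupp_integrable cf sf.
pose p0 : R * R * R := (x 0 0, x 0 1, x 0 2%:R).
have vp0 : vec3 p0 = x.
  by apply/rowP => -[[|[|[|//]]] jlt]; rewrite !mxE/=; congr (x 0 _); exact: val_inj.
have cg : continuous (fun p => f (vec3 p)).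
  by move=> p; apply: continuous_comp; [exact: vec3_continuous|exact: cf].
have : \forall p \near p0, f x / 2 < f (vec3 p).
  by apply: (cvgr_gt _ (cg p0)); rewrite vp0; lra.
move=> /nbhs_ballP[e /= e0 he].
pose B : set M3 := (ball (x 0 0) e `*` ball (x 0 1) e) `*` ball (x 0 2%:R) e.
have mB : measurable B.
  apply: measurableX; last exact: measurable_ball.
  by apply: measurableX; exact: measurable_ball.
have Bpos : (0 < mu3 B)%E.
  have hb (y : R) : (0 < mu (ball y e))%E.
    by rewrite lebesgue_measure_ball ?ltW// lte_fin pmulrn_rgt0.
  have m2 : measurable ((ball (x 0 0) e : set RT) `*` (ball (x 0 1) e : set RT)).
    by apply: measurableX; exact: measurable_ball.
  have h2 := product_measure1E mu mu (measurable_ball (x 0 0) e) (measurable_ball (x 0 1) e).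
  have h3 := product_measure1E mu2 mu m2 (measurable_ball (x 0 2%:R) e).
  by rewrite /B h3 [X in (X * _)%E]h2; apply: mule_gt0; [apply: mule_gt0|]; exact: hb.
have mf := measurable_int _ If'.
have fx2 : 0 < f x / 2 by lra.
have := le_integral_abse mu3 measurableT mf fx2; rewrite setTI.
have -> : (\int[mu3]_p `|(EFin \o (fun p : M3 => f (vec3 p))) p| = 0)%E.
  under eq_integral do rewrite gee0_abs ?lee_fin//.
  have := integrable_fin_num measurableT If' => h.
  by rewrite -[LHS]fineK//=; congr (_%:E).
move=> h; suff : (0 < (f x / 2)%:E * mu3 [set p : M3 | ((f x / 2)%:E <= `|(f (vec3 p))%:E|)%E])%E.
  by rewrite ltNge h.
rewrite mule_gt0 ?lte_fin ?divr_gt0//; apply: (lt_le_trans Bpos).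
apply: le_measure; rewrite ?inE//.
- rewrite -[X in measurable X]setTI; apply: emeasurable_fun_c_infty => //.
  exact: measurableT_comp.
- move=> p [] [] /= h0 h1 h2; rewrite lee_fin ger0_norm//; apply/ltW/he.
  by split.
Qed.

Lemma prod_bounded (g : R * V -> R) T L : continuous g ->
  exists2 M, 0 <= M & forall t x, 0 <= t <= T -> `|x| <= L -> `|g (t, x)| <= M.
Proof.
move=> cg.
have cK : compact (`[0, T]%classic `*` [set x : V | `|x| <= L]).
  by apply: compact_setX; [exact: segment_compact|exact: compact_norm_le].
have /compact_bounded[M [_ hM]] := continuous_compact (continuous_subspaceT cg) cK.
exists (`|M| + 1) => // t x tT xL.
apply: (hM (`|M| + 1)); first by rewrite (le_lt_trans (ler_norm _))// ltrDl.
by exists (t, x) => //; split => //=; rewrite in_itv.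
Qed.


Definition clamp (T t : R) : R := Num.max 0 (Num.min t T).

Lemma clamp_continuous T : continuous (clamp T).
Proof.
move=> t; rewrite /clamp.
apply: (@continuous_max _ _ (fun=> 0) (fun t => Num.min t T)); first exact: cvg_cst.
by apply: (@continuous_min _ _ id (fun=> T)); [exact: cvg_id|exact: cvg_cst].
Qed.

Lemma clamp_in T t : 0 <= T -> 0 <= clamp T t <= T.
Proof.
by move=> T0; rewrite /clamp le_max lexx /= ge_max T0 ge_min lexx orbT.
Qed.

Lemma clamp_id T t : 0 <= t <= T -> clamp T t = t.
Proof.
by move=> /andP[t0 tT]; rewrite /clamp (min_idPl tT) (max_idPr t0).
Qed.

(* Functions on the slab [0, T] x R^3 are extended continuously in time by
   freezing them outside [0, T], so that no subspace topology is needed. *)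
Definition slab_continuous T (f : R -> V -> R) :=
  continuous (fun p : R * V => f (clamp T p.1) p.2).

(** A C^1 function on the slab bundled with its first derivatives. Time derivatives are two-sided
    and hence required at interior times only, but they extend continuously to the closed slab. The
    operations below make such fields an algebra. *)
Record fld (T : R) := Fld {
  fv : R -> V -> R;
  ft : R -> V -> R;
  fx : 'I_3 -> R -> V -> R;
  fv_cont : slab_continuous T fv;
  ft_cont : slab_continuous T ft;
  fx_cont : forall i, slab_continuous T (fx i);
  ft_der : forall t x, 0 < t < T -> is_derive t 1 (fv^~ x) (ft t x);
  fx_der : forall i t x, 0 <= t <= T -> is_derive x 'e_i (fv t) (fx i t x)
}.

Arguments fv_cont {T} f.
Arguments ft_cont {T} f.
Arguments fx_cont {T} f i.

Section operations.
Variable T : R.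
Hypothesis T0 : 0 <= T.

Lemma slab_continuous_cst (c : R) : slab_continuous T (fun _ _ => c).
Proof. by move=> p; exact: cvg_cst. Qed.

Lemma slab_continuousD f g : slab_continuous T f -> slab_continuous T g ->
  slab_continuous T (fun t x => f t x + g t x).
Proof. by move=> cf cg p; exact: (cvgD (cf p) (cg p)). Qed.

Lemma slab_continuousM f g : slab_continuous T f -> slab_continuous T g ->
  slab_continuous T (fun t x => f t x * g t x).
Proof. by move=> cf cg p; exact: (cvgM (cf p) (cg p)). Qed.

Lemma slab_continuous_comp f (h : R -> R) : slab_continuous T f ->
  (forall t x, 0 <= t <= T -> {for f t x, continuous h}) ->
  slab_continuous T (fun t x => h (f t x)).
Proof.
move=> cf ch p.
apply: (@continuous_comp _ _ _ (fun p => f (clamp T p.1) p.2) h p (cf p)).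
exact/ch/clamp_in.
Qed.

Definition fcst (c : R) : fld T :=
  @Fld T (fun _ _ => c) (fun _ _ => 0) (fun _ _ _ => 0)
    (@slab_continuous_cst c) (@slab_continuous_cst 0)
    (fun _ => @slab_continuous_cst 0)
    (fun t _ _ => is_derive_cst c t 1) (fun i _ x _ => is_derive_cst c x 'e_i).

(** Built transparently, here and below, so that the derivatives of a composite field reduce to
    explicit expressions that [ring] can handle. *)
Definition fadd (f g : fld T) : fld T.
Proof.
apply: (@Fld T (fun t x => fv f t x + fv g t x) (fun t x => ft f t x + ft g t x)
   (fun i t x => fx f i t x + fx g i t x)).
- by apply: slab_continuousD; exact: fv_cont.
- by apply: slab_continuousD; exact: ft_cont.
- by move=> i; apply: slab_continuousD; exact: fx_cont.
- by move=> t x tT; apply: is_deriveD; exact: ft_der.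
- by move=> i t x tT; apply: is_deriveD; exact: fx_der.
Defined.

Definition fmul (f g : fld T) : fld T.
Proof.
apply: (@Fld T (fun t x => fv f t x * fv g t x)
   (fun t x => fv f t x * ft g t x + fv g t x * ft f t x)
   (fun i t x => fv f t x * fx g i t x + fv g t x * fx f i t x)).
- by apply: slab_continuousM; exact: fv_cont.
- by apply: slab_continuousD; apply: slab_continuousM; (exact: fv_cont || exact: ft_cont).
- by move=> i; apply: slab_continuousD; apply: slab_continuousM; (exact: fv_cont || exact: fx_cont).
- by move=> t x tT; apply: is_deriveM; exact: ft_der.
- by move=> i t x tT; apply: is_deriveM; exact: fx_der.
Defined.

Lemma slab_continuous_time : slab_continuous T (fun t _ => t).
Proof.
move=> p; apply: (@continuous_comp _ _ _ (fst : R * V -> R) (clamp T) p); first exact: cvg_fst.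
exact: clamp_continuous.
Qed.

Definition ftime : fld T :=
  @Fld T (fun t _ => t) (fun _ _ => 1) (fun _ _ _ => 0)
    slab_continuous_time (@slab_continuous_cst 1) (fun _ => @slab_continuous_cst 0)
    (fun t _ _ => is_derive_id t 1) (fun i t x _ => is_derive_cst t x 'e_i).

Lemma is_derive_coord (i j : 'I_3) (x : V) :
  is_derive x 'e_i (fun y : V => y 0 j) (i == j)%:R.
Proof.
have h : (fun h : R => h^-1 *: (((fun y : V => y 0 j) \o shift x) (h *: 'e_i) - x 0 j)) @ 0^'
   --> ((i == j)%:R : R).
  apply: cvg_near_cst; near=> h.
  rewrite /= !mxE addrK eqxx/= eq_sym; case: eqP => _ /=; last by rewrite mulr0 scaler0.
  by rewrite mulr1 /GRing.scale/= mulVf//; near: h; exact: nbhs_dnbhs_neq.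
by split; [apply/cvg_ex; exists (i == j)%:R|apply/cvg_lim].
Unshelve. all: by end_near. Qed.

Lemma slab_continuous_coord (j : 'I_3) : slab_continuous T (fun _ x => x 0 j).
Proof.
move=> p; apply: (@continuous_comp _ _ _ (snd : R * V -> V) (fun x : V => x 0 j) p); first exact: cvg_snd.
exact: coord_continuous.
Qed.

Definition fcoord (j : 'I_3) : fld T :=
  @Fld T (fun _ x => x 0 j) (fun _ _ => 0) (fun i _ _ => (i == j)%:R)
    (@slab_continuous_coord j) (@slab_continuous_cst 0)
    (fun _ => @slab_continuous_cst _)
    (fun t x _ => is_derive_cst (x 0 j) t 1) (fun i _ x _ => is_derive_coord i j x).

(** Only a directional derivative of [f] is given, not a differential, so the one-variable chain
    rule is applied to [f] on the line through [x] with direction [v]. *)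
Lemma is_derive_comp_dir (f : V -> R) (h : R -> R) (x v : V) a b :
  is_derive x v f a -> is_derive (f x) 1 h b -> is_derive x v (h \o f) (b * a).
Proof.
move=> [f1 f2] hb.
pose k (s : R) := f (s *: v + x).
have dk : is_derive (0 : R) 1 k a.
  have e : (fun s : R => s^-1 *: ((k \o shift 0) (s *: 1) - k 0)) =
           (fun s : R => s^-1 *: ((f \o shift x) (s *: v) - f x)).
    by apply/funext => s; rewrite /k /= [s *: 1]mulr1 addr0 scale0r add0r.
  by split; [rewrite /derivable e|rewrite /derive e].
have k0 : k 0 = f x by rewrite /k scale0r add0r.
have [c1 c2] : is_derive (0 : R) 1 (h \o k) (b * a).
  by apply: is_derive1_comp => //; rewrite k0.
have e : (fun s : R => s^-1 *: (((h \o k) \o shift 0) (s *: 1) - (h \o k) 0)) =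
         (fun s : R => s^-1 *: (((h \o f) \o shift x) (s *: v) - (h \o f) x)).
  by apply/funext => s; rewrite /k /= [s *: 1]mulr1 addr0 scale0r add0r.
by split; [move: c1; rewrite /derivable e|move: c2; rewrite /derive e].
Qed.

(** Regularity of [h] is asked only at values that the field takes: real powers are composed with
    positive densities. *)
Definition fcomp (f : fld T) (h h' : R -> R)
  (dh : forall t x, 0 <= t <= T -> is_derive (fv f t x) 1 h (h' (fv f t x)))
  (ch' : forall t x, 0 <= t <= T -> {for fv f t x, continuous h'}) : fld T.
Proof.
apply: (@Fld T (fun t x => h (fv f t x)) (fun t x => h' (fv f t x) * ft f t x)
   (fun i t x => h' (fv f t x) * fx f i t x)).
- apply: slab_continuous_comp; first exact: fv_cont.
  move=> t x tT; apply: differentiable_continuous; apply/derivable1_diffP.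
  by have [] := dh t x tT.
- by apply: slab_continuousM; [apply: slab_continuous_comp|]; (exact: fv_cont || exact: ft_cont || exact: ch').
- by move=> i; apply: slab_continuousM; [apply: slab_continuous_comp|]; (exact: fv_cont || exact: fx_cont || exact: ch').
- move=> t x /andP[t0 tT].
  apply: (@is_derive1_comp _ h (fv f ^~ x)); first by apply: dh; rewrite !ltW.
  by apply: ft_der; rewrite t0.
- move=> i t x tT; apply: (is_derive_comp_dir (f := fv f t)); first exact: fx_der.
  exact: dh.
Defined.

End operations.

End slab_fields.

Arguments fv_cont {R T} f.
Arguments ft_cont {R T} f.
Arguments fx_cont {R T} f i.

(** * Time derivatives of integrals over R^3 *)

Section balance.
Variable R : realType.
Local Notation mu := (@lebesgue_measure R).
Local Notation mu2 := (mu \x mu)%E.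
Local Notation mu3 := (mu2 \x mu)%E.
Local Notation RT := (measurableTypeR R).
Local Notation M3 := (RT * RT * RT)%type.
Local Notation V := 'rV[R]_3.
Variables (T L : R).
Hypothesis T0 : 0 < T.

Lemma pair_continuousr (t : R) (x : V) : {for x, continuous (fun x : V => (t, x))}.
Proof.
exact: (@cvg_pair _ _ _ (nbhs x) (nbhs t) (nbhs x) _ _ _ (fun=> t) id (cvg_cst _) cvg_id).
Qed.

Lemma pair_continuousl (t : R) (x : V) : {for t, continuous (fun t : R => (t, x))}.
Proof.
exact: (@cvg_pair _ _ _ (nbhs t) (nbhs t) (nbhs x) _ _ _ id (fun=> x) cvg_id (cvg_cst _)).
Qed.

(** A continuous, compactly supported majorant of the indicator of the cube [|x| <= L]; its
    multiples are the dominating functions below. *)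
Definition hat (x : V) : R := Num.max 0 (L + 1 - `|x|).

Lemma hat_ge0 x : 0 <= hat x.
Proof. by rewrite le_max lexx. Qed.

Lemma hat_ge1 x : `|x| <= L -> 1 <= hat x.
Proof. by move=> xL; rewrite le_max; apply/orP; right; lra. Qed.

Lemma hat_continuous : continuous hat.
Proof.
move=> x; apply: (@continuous_max _ _ (fun _ : V => 0 : R) (fun x : V => L + 1 - `|x|)).
  exact: cst_continuous.
exact: (cvgB (cvg_cst _) (@norm_continuous _ _ x)).
Qed.

Lemma hat_csupp : csupp (L + 1) hat.
Proof. by move=> x xL; apply/max_idPl; lra. Qed.

Lemma hat_int3able c : int3able (fun x => c * hat x).
Proof. exact: int3ableZ (csupp_int3able hat_continuous hat_csupp). Qed.

Lemma le_hat c (g : V -> R) x : 0 <= c -> (L < `|x| -> g x = 0) ->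
  (`|x| <= L -> `|g x| <= c) -> `|g x| <= c * hat x.
Proof.
move=> c0 g0 gc; have [xL|Lx] := leP `|x| L.
  by rewrite (le_trans (gc xL))// ler_peMr// hat_ge1.
by rewrite g0// normr0 mulr_ge0// hat_ge0.
Qed.

Lemma slice_continuous (f : R -> V -> R) t : slab_continuous T f ->
  0 <= t <= T -> continuous (f t).
Proof.
move=> cf tT x.
have -> : f t = (fun p : R * V => f (clamp T p.1) p.2) \o (fun x => (t, x)).
  by apply/funext => y /=; rewrite clamp_id.
apply: continuous_comp; last exact: cf.
exact: pair_continuousr.
Qed.

Lemma slab_bounded (f : R -> V -> R) K : slab_continuous T f ->
  exists2 M, 0 <= M & forall t x, 0 <= t <= T -> `|x| <= K -> `|f t x| <= M.
Proof.
move=> cf; have [M M0 hM] := prod_bounded T K cf.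
by exists M => // t x tT xL; have := hM t x tT xL; rewrite /= clamp_id.
Qed.

Variables (f : fld T) (q : 'I_3 -> fld T).
Hypothesis f_supp : forall t, 0 <= t <= T -> csupp L (fv f t).
Hypothesis q_supp : forall i t, 0 <= t <= T -> csupp L (fv (q i) t).

Lemma int3_slice_continuous :
  {within `[0, T], continuous (fun t => int3 (fv f t))}.
Proof.
have T0' := ltW T0.
have [M M0 hM] := slab_bounded L (fv_cont f).
(* Freezing the time outside [0, T] makes 0 and T interior points of an open interval, where
   continuity under the integral applies. *)
have cl : {in [set` `]-1, T + 1[], continuous (fun t => int3 (fv f (clamp T t)))}.
  have tin t := clamp_in t T0'.
  apply: (@continuity_under_integral _ _ _ mu3 (fun t (p : M3) => fv f (clamp T t) (vec3 p)) setT measurableT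
      (-1) (T + 1) _ _ (fun p : M3 => M * hat (vec3 p))).
  - move=> t _; apply: csupp_integrable (f_supp (tin t)).
    exact: slice_continuous (fv_cont f) (tin t).
  - apply: aeW => p _ t _.
    apply: (@continuous_comp _ _ _ (fun t : R => (t, vec3 p)) (fun p : R * V => fv f (clamp T p.1) p.2)); last exact: fv_cont.
    exact: pair_continuousl.
  - exact: hat_int3able.
  - move=> t _; apply: aeW => p _; apply: le_hat => //.
      by move=> h; apply: f_supp => //; exact: ltW.
    exact: hM.
have e : {in `[0, T], (fun t => int3 (fv f (clamp T t))) =1 (fun t => int3 (fv f t))}.
  by move=> t; rewrite in_itv/= => tT; rewrite clamp_id.
apply: (@subspace_eq_continuous _ _ _ (fun t => int3 (fv f (clamp T t)))).
  by move=> t /set_mem tT; apply: e.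
apply: continuous_in_subspaceT => t /set_mem/= /[!in_itv]/= tT.
by apply: cl; rewrite inE/= in_itv/=; lra.
Qed.


Lemma ft_eq0 t x : 0 < t < T -> L <= `|x| -> ft f t x = 0.
Proof.
move=> tT Lx; have [_ <-] := ft_der f x tT.
rewrite (near_eq_derive _ (g := fun=> 0)) ?derive_cst//.
near=> s; apply: f_supp => //.
have : s \in `]0, T[ by near: s; exact: near_in_itvoo.
by rewrite in_itv/= => /andP[? ?]; rewrite !ltW.
Unshelve. all: by end_near. Qed.

(** The inequality is strict because a spatial derivative is known to vanish only where [g] is zero
    in a neighbourhood; this is why [balance] uses the cube of half-side [L + 1] for the flux
    derivatives. *)
Lemma fx_eq0 (g : fld T) i t x : (forall t, 0 <= t <= T -> csupp L (fv g t)) ->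
  0 <= t <= T -> L < `|x| -> fx g i t x = 0.
Proof.
move=> g0 tT Lx; have [_ <-] := fx_der g i x tT.
rewrite (near_eq_derive _ (g := fun=> 0)) ?derive_cst//.
near=> y; apply: (g0 t) => //; apply: ltW; near: y.
by apply: (cvgr_gt _ (@norm_continuous _ _ x)).
Unshelve. all: by end_near. Qed.

Variable s : R -> V -> R.
Hypothesis fqs : forall t x, 0 < t < T ->
  ft f t x + \sum_(i < 3) fx (q i) i t x = s t x.

(** Dominated differentiation under the integral gives the integral of [ft f], and each flux
    derivative integrates to zero. Integrability of [s t] follows from that of the other terms. *)
Lemma balance t : 0 < t < T ->
  int3able (s t) /\ is_derive t 1 (fun t => int3 (fv f t)) (int3 (s t)).
Proof.
move=> tT; have tT' : 0 <= t <= T by case/andP: tT => *; rewrite !ltW.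
have [M M0 hM] := slab_bounded L (ft_cont f).
have I_ft : int3able (ft f t).
  apply: (@csupp_int3able _ L); first exact: slice_continuous (ft_cont f) tT'.
  by move=> x; exact: ft_eq0.
have q0 i : int3able (fx (q i) i t) /\ int3 (fx (q i) i t) = 0.
  have c0 : continuous (fx (q i) i t) by exact: slice_continuous (fx_cont (q i) i) tT'.
  have s0 : csupp (L + 1) (fx (q i) i t).
    by move=> x Lx; apply: fx_eq0 => //; [exact: q_supp|lra].
  split; first exact: csupp_int3able c0 s0.
  apply: (@int3_derivative _ (L + 1) (fv (q i) t) _ i) => //.
    by move=> x Lx; apply: q_supp => //; lra.
  by move=> x; exact: fx_der.
have [[I0 E0] [I1 E1] [I2 E2]] : [/\ int3able (fx (q 0) 0 t) /\ int3 (fx (q 0) 0 t) = 0,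
   int3able (fx (q 1) 1 t) /\ int3 (fx (q 1) 1 t) = 0 &
   int3able (fx (q 2%:R) 2%:R t) /\ int3 (fx (q 2%:R) 2%:R t) = 0] by split; exact: q0.
have es : s t = (fun x => ft f t x + (fx (q 0) 0 t x + (fx (q 1) 1 t x + fx (q 2%:R) 2%:R t x))).
  by apply/funext => x; rewrite -fqs// sum3 !addrA.
have I12 := int3ableD I1 I2; have I012 := int3ableD I0 I12.
split; first by rewrite es; exact: int3ableD.
rewrite es int3D// int3D// int3D// E0 E1 E2 !addr0.
have It : [set` `]0, T[] t by rewrite /= in_itv.
have der u x : [set` `]0, T[] u -> is_derive u 1 (fv f ^~ x) (ft f u x).
  by rewrite /= in_itv/= => uT; exact: ft_der.
have d1 u x : [set` `]0, T[] u -> partial1of2 (fun t (p : M3) => fv f t (vec3 p)) u x = ft f u (vec3 x).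
  by move=> uT; rewrite partial1of2E; have [_ ->] := der u (vec3 x) uT.
have hint : forall u, [set` `]0, T[] u -> mu3.-integrable setT (EFin \o (fun p : M3 => fv f u (vec3 p))).
  move=> u; rewrite /= in_itv/= => /andP[u0 uT]; have uT' : 0 <= u <= T by rewrite !ltW.
  apply: csupp_integrable (f_supp uT'); exact: slice_continuous (fv_cont f) uT'.
have hder u (p : M3) : [set` `]0, T[] u -> setT p -> derivable (fun t => fv f t (vec3 p)) u 1.
  by move=> uT _; have [] := der u (vec3 p) uT.
have G0 (p : M3) : 0 <= M * hat (vec3 p) by rewrite mulr_ge0// hat_ge0.
have hdom u (p : M3) : [set` `]0, T[] u -> setT p ->
    `|partial1of2 (fun t (p : M3) => fv f t (vec3 p)) u p| <= M * hat (vec3 p).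
  move=> uI _; rewrite d1//; move: uI; rewrite /= in_itv/= => uT.
  apply: le_hat => //; first by move=> Lx; rewrite ft_eq0// ltW.
  by move=> xL; apply: hM => //; case/andP: uT => *; rewrite !ltW.
have e1 := derivable_under_integral measurableT It hint hder G0 (hat_int3able M) hdom.
have e2 := differentiation_under_integral measurableT It hint hder G0 (hat_int3able M) hdom.
split; first exact: e1.
rewrite -derive1E; rewrite /int3 [LHS]e2.
by apply: eq_Rintegral => p _; exact: d1.
Qed.

End balance.

(** * From C^1 functions on the slab to fields *)

Section fields_of_solution.
Variable R : realType.
Local Notation V := 'rV[R]_3.
Variable T : R.
Hypothesis T0 : 0 < T.

Lemma cont_slab_continuous (f : R -> V -> R) : cont_slab T f -> slab_continuous T f.
Proof.
move=> cf p.
pose g (p : R * V) : R * V := (clamp T p.1, p.2).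
have cg : g @ p --> g p.
  apply: (@cvg_pair _ _ _ _ (nbhs (clamp T p.1)) (nbhs p.2)).
    by apply: (@continuous_comp _ _ _ (fst : R * V -> R) (clamp T) p); [exact: cvg_fst|exact: clamp_continuous].
  exact: cvg_snd.
have gs q : slab T (g q) by exact: (clamp_in q.1 (ltW T0)).
have /subspace_continuousP/(_ (g p) (gs p)) cfp := cf.
apply: (@cvg_comp _ _ _ g (fun p : R * V => f p.1 p.2) _ (within (slab T) (nbhs (g p))) _ _ cfp).
move=> A /= hA; have := cg _ hA.
by rewrite /= !nbhs_simpl/=; apply: filterS => q; apply; exact: gs.
Qed.

(** At an interior time the constraint [0 <= t + h <= T] holds for all small [h], so the two filters
    of difference quotients coincide. *)
Lemma tquot_is_derive (f : R -> V -> R) t x : 0 < t < T -> cvg (tquot T f t x) ->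
  is_derive t 1 (f^~ x) (dt T f t x).
Proof.
move=> tT ct.
have e : (fun h => h^-1 *: ((f^~ x \o shift t) (h *: 1) - f t x)) @ 0^' = tquot T f t x.
  have e1 : (fun h => h^-1 *: ((f^~ x \o shift t) (h *: 1) - f t x)) =
     (fun h => h^-1 * (f (t + h) x - f t x)).
    by apply/funext => h /=; rewrite /GRing.scale/= mulr1 (addrC h).
  rewrite e1 /tquot; apply/seteqP; split => A /=; rewrite !nbhs_simpl/=.
    by apply: filterS => h + _.
  have t0 : (0 : R) \in `](- t), (T - t)[.
    by case/andP: tT => *; rewrite in_itv/=; apply/andP; split; lra.
  move: (near_in_itvoo t0) => h0; rewrite /within/= => hA.
  rewrite /dnbhs /within/= in hA *; move: h0 hA; apply: filterS2 => h.
  by rewrite in_itv/= => /andP[? ?] h1 h2; apply: h1 => //; apply/andP; split; lra.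
by split; [rewrite /derivable e|rewrite /derive e].
Qed.

Lemma C1_slab_derive_time f t x : C1_slab T f -> 0 < t < T ->
  is_derive t 1 (f^~ x) (dt T f t x).
Proof.
move=> [h _ _ _] tT; apply: tquot_is_derive => //.
by apply: (h t x _).1; case/andP: tT => *; rewrite !ltW.
Qed.

Lemma C1_slab_derive_space f i t x : C1_slab T f -> 0 <= t <= T ->
  is_derive x 'e_i (f t) (dx i (f t) x).
Proof. by move=> [h _ _ _] tT; split => //; exact: (h t x tT).2. Qed.

Lemma C1_slab_continuous f : C1_slab T f -> slab_continuous T f.
Proof. by case=> *; exact: cont_slab_continuous. Qed.

Lemma C1_slab_continuous_dt f : C1_slab T f -> slab_continuous T (dt T f).
Proof. by case=> *; exact: cont_slab_continuous. Qed.

Lemma C1_slab_continuous_dx f : C1_slab T f ->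
  forall i, slab_continuous T (fun t => dx i (f t)).
Proof. by case=> ? ? ? h i; exact: cont_slab_continuous. Qed.

Definition fld_of_C1 (f : R -> V -> R) (hf : C1_slab T f) : fld T :=
  @Fld R T f (dt T f) (fun i t => dx i (f t)) (C1_slab_continuous hf)
    (C1_slab_continuous_dt hf) (C1_slab_continuous_dx hf)
    (fun t x => C1_slab_derive_time x hf) (fun i t x => C1_slab_derive_space i x hf).

Section restriction.
Variable T' : R.
Hypotheses (T'0 : 0 <= T') (T'T : T' <= T).

Lemma slab_continuous_restr f : slab_continuous T f -> slab_continuous T' f.
Proof.
move=> cf p.
have -> : (fun p : R * V => f (clamp T' p.1) p.2)
   = (fun p : R * V => f (clamp T p.1) p.2) \o (fun p : R * V => (clamp T' p.1, p.2)).
  apply/funext => -[t x] /=; rewrite (@clamp_id _ T)//.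
  by have /andP[-> h] := clamp_in t T'0; exact: le_trans T'T.
apply: continuous_comp; last exact: cf.
apply: (@cvg_pair _ _ _ _ (nbhs (clamp T' p.1)) (nbhs p.2)).
  by apply: (@continuous_comp _ _ _ (fst : R * V -> R) (clamp T') p); [exact: cvg_fst|exact: clamp_continuous].
exact: cvg_snd.
Qed.

Let sub_oo t : 0 < t < T' -> 0 < t < T.
Proof. by move=> /andP[-> h]; exact: lt_le_trans T'T. Qed.

Let sub_cc t : 0 <= t <= T' -> 0 <= t <= T.
Proof. by move=> /andP[-> h]; exact: le_trans T'T. Qed.

(** The cone estimate speaks of the final time of a slab; restriction makes any positive time
    final. *)
Definition frestr (f : fld T) : fld T' :=
  @Fld R T' (fv f) (ft f) (fx f) (slab_continuous_restr (fv_cont f))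
    (slab_continuous_restr (ft_cont f)) (fun i => slab_continuous_restr (fx_cont f i))
    (fun t x h => ft_der f x (sub_oo h)) (fun i t x h => fx_der f i x (sub_cc h)).

End restriction.

End fields_of_solution.

(** * Pressure, real powers and Gronwall *)

Section real_lemmas.
Variable R : realType.

Lemma pressure_derive (A gamma r : R) : 0 < r ->
  is_derive r 1 (pressure A gamma) (A * gamma * r `^ (gamma - 1)).
Proof.
move=> r0; have d := is_derive1_powR gamma r0.
by apply: is_derive_eq; rewrite /GRing.scale/=; ring.
Qed.

Lemma cs2E (A gamma r : R) : 0 < r -> cs2 A gamma r = A * gamma * r `^ (gamma - 1).
Proof. by move=> r0; rewrite /cs2 derive1E; have [_ ->] := pressure_derive A gamma r0. Qed.

Lemma is_derive_continuous (f : R -> R) (x d : R) : is_derive x 1 f d -> {for x, continuous f}.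
Proof. by case=> h _; apply: differentiable_continuous; apply/derivable1_diffP. Qed.

(** Mean value theorem with the derivative bounded on a compact interval. The exponent used later,
    [gamma - 1], may be less than 1, so the interval must stay away from 0. *)
Lemma powR_lipschitz (a m M : R) : 0 < m -> exists2 K, 0 <= K &
  forall x y, m <= x <= M -> m <= y <= M -> `|x `^ a - y `^ a| <= K * `|x - y|.
Proof.
move=> m0.
have cp (p x : R) : m <= x -> {for x, continuous (fun y : R => y `^ p)}.
  by move=> mx; apply: is_derive_continuous; apply: is_derive1_powR; exact: lt_le_trans mx.
have cw : {within `[m, M], continuous (fun x : R => a * x `^ (a - 1))}.
  apply: continuous_in_subspaceT => x /set_mem/= /[!in_itv]/= /andP[mx _].
  exact: (cvgM (cvg_cst a) (cp (a - 1) x mx)).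
have /compact_bounded[K [_ hK]] := continuous_compact cw (@segment_compact _ m M).
exists (`|K| + 1) => //.
have bnd x : x \in `[m, M] -> `|a * x `^ (a - 1)| <= `|K| + 1.
  move=> xI; apply: (hK (`|K| + 1)); first by rewrite (le_lt_trans (ler_norm _))// ltrDl.
  by exists x.
suff main x y : x <= y -> m <= x <= M -> m <= y <= M -> `|x `^ a - y `^ a| <= (`|K| + 1) * `|x - y|.
  move=> x y; have [xy|/ltW yx] := leP x y; first exact: main.
  by move=> h1 h2; rewrite distrC (distrC x y); exact: main.
move=> xy /andP[mx xM] /andP[my yM].
have [|||c cxy e] := @MVT_segment _ (fun y : R => y `^ a) (fun x : R => a * x `^ (a - 1)) x y.
- by [].
- move=> z; rewrite in_itv/= => /andP[xz _]; apply: is_derive1_powR; lra.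
- apply: continuous_in_subspaceT => z /set_mem/= /[!in_itv]/= /andP[xz _].
  by apply: cp; lra.
rewrite distrC e normrM (distrC x) ler_wpM2r//; apply: bnd.
by move: cxy; rewrite !in_itv/= => /andP[? ?]; apply/andP; split; lra.
Qed.

(** The product of [E] with exp(- C t) is nonincreasing. [C] may have either sign: it is nonnegative
    for the cone energy and [- tau^-1] for the bulk integral. *)
Lemma gronwall (E E' : R -> R) (C T : R) : {within `[0, T], continuous E} ->
  (forall t, 0 < t < T -> is_derive t 1 E (E' t) /\ E' t <= C * E t) ->
  E 0 <= 0 -> forall t, 0 <= t <= T -> E t <= 0.
Proof.
move=> cE dE E0 t /andP[t0 tT].
pose F t := E t * expR (- C * t).
have dx (s : R) : is_derive s 1 (fun s => expR (- C * s)) (expR (- C * s) * - C).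
  apply: (@is_derive1_comp _ expR (fun s => - C * s)).
  by apply: is_derive_eq; rewrite /GRing.scale/=; ring.
have dF s : 0 < s < T -> is_derive s 1 F (E s * (expR (- C * s) * - C) + expR (- C * s) * E' s).
  by move=> sT; have [h _] := dE s sT; exact: is_deriveM.
have /(_ 0 t) : forall x y, 0 <= x -> x <= y -> y <= T -> F y <= F x.
  apply: ler0_derive1_nincr.
  - by move=> s; rewrite in_itv/= => /dF[].
  - move=> s; rewrite in_itv/= => sT; rewrite derive1E; have [_ ->] := dF s sT.
    have [_ h] := dE s sT.
    have -> : E s * (expR (- C * s) * - C) + expR (- C * s) * E' s
      = expR (- C * s) * (E' s - C * E s) by ring.
    by rewrite mulr_ge0_le0 ?expR_ge0// subr_le0.
  - move=> x; apply: (@cvgM _ _ (nbhs (x : subspace `[0, T])) _ E (fun s => expR (- C * s))); first exact: cE.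
    by apply: continuous_subspaceT => s; exact: is_derive_continuous (dx s).
move=> /(_ (lexx _) t0 tT); rewrite /F mulr0 expR0 mulr1 => h.
by have := le_trans h E0; rewrite pmulr_lle0 ?expR_gt0.
Qed.

End real_lemmas.
(** * Finite speed of propagation *)

Section cone_algebra.
Variable R : realType.

Lemma ler_normD_bound (a b c d : R) : `|a| <= c -> `|b| <= d -> `|a + b| <= c + d.
Proof. by move=> h1 h2; rewrite (le_trans (ler_normD _ _))// lerD. Qed.

Lemma ler_normM_bound (a b c d : R) : `|a| <= c -> `|b| <= d -> `|a * b| <= c * d.
Proof. by move=> h1 h2; rewrite normrM ler_pM. Qed.

Lemma ler_normN_bound (a c : R) : `|a| <= c -> `|- a| <= c.
Proof. by rewrite normrN. Qed.

Lemma le_addends3 (a b c : R) : 0 <= a -> 0 <= b -> 0 <= c ->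
  [/\ a <= a + b + c, b <= a + b + c & c <= a + b + c].
Proof. by move=> *; split; lra. Qed.

Lemma cauchy_schwarz3 (a b c x y z : R) :
  (a * x + b * y + c * z) ^+ 2 <= (a ^+ 2 + b ^+ 2 + c ^+ 2) * (x ^+ 2 + y ^+ 2 + z ^+ 2).
Proof.
rewrite -subr_ge0.
have -> : (a ^+ 2 + b ^+ 2 + c ^+ 2) * (x ^+ 2 + y ^+ 2 + z ^+ 2) - (a * x + b * y + c * z) ^+ 2
  = (a * y - b * x) ^+ 2 + (a * z - c * x) ^+ 2 + (b * z - c * y) ^+ 2 by ring.
by rewrite !addr_ge0 ?sqr_ge0.
Qed.

(** Here [s] and [p] are the perturbations of density and bulk pressure, [Y] is the scalar product
    of x - xs with v, and [a] is the radius of the cone at the given time. Cauchy-Schwarz gives (pb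
    s + p)^2 <= rb c^2 B with B = pb s^2 / rb + p^2 / bb, the deficit being an explicit square that
    vanishes for s = rb p / bb; this fixes the value of c. The arithmetic-geometric mean of rb v2
    and B then yields the energy. *)
Lemma flux_bound (rb pb bb c a s p Y y2 v2 : R) : 0 < rb -> 0 < pb -> 0 < bb ->
  0 <= a -> 0 <= c -> 0 <= v2 -> c ^+ 2 = pb + bb / rb ->
  Y ^+ 2 <= y2 * v2 -> y2 <= a ^+ 2 ->
  `|(pb * s + p) * Y| <= a * c * (rb / 2 * v2 + pb / (2 * rb) * s ^+ 2 + p ^+ 2 / (2 * bb)).
Proof.
move=> rb0 pb0 bb0 a0 c0 v20 hc hY hy.
have rbn : rb != 0 by rewrite gt_eqF. have bbn : bb != 0 by rewrite gt_eqF.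
pose B := pb / rb * s ^+ 2 + p ^+ 2 / bb.
have [rb0' pb0' bb0'] : [/\ 0 <= rb, 0 <= pb & 0 <= bb] by rewrite !ltW.
have B0 : 0 <= B by rewrite addr_ge0// mulr_ge0 ?sqr_ge0 ?divr_ge0 ?invr_ge0.
have q2 : (pb * s + p) ^+ 2 <= rb * c ^+ 2 * B.
  rewrite hc -subr_ge0.
  have -> : rb * (pb + bb / rb) * B - (pb * s + p) ^+ 2
    = pb * bb / rb * (s - rb / bb * p) ^+ 2 by rewrite /B; field; rewrite rbn bbn.
  by rewrite mulr_ge0 ?sqr_ge0// divr_ge0 ?mulr_ge0.
have e0 : rb / 2 * v2 + pb / (2 * rb) * s ^+ 2 + p ^+ 2 / (2 * bb) = (rb * v2 + B) / 2.
  by rewrite /B; field; rewrite rbn bbn.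
rewrite e0.
have rv0 : 0 <= rb * v2 by rewrite mulr_ge0.
rewrite -(@ler_pXn2r _ 2) ?nnegrE ?normr_ge0//; last first.
  have h1 : 0 <= a * c by exact: mulr_ge0.
  have h2 : 0 <= rb * v2 + B by exact: addr_ge0.
  by rewrite mulr_ge0// divr_ge0.
rewrite real_normK ?num_real// exprMn.
have Y2 : Y ^+ 2 <= a ^+ 2 * v2 by rewrite (le_trans hY)// ler_wpM2r.
apply: (@le_trans _ _ ((rb * c ^+ 2 * B) * (a ^+ 2 * v2))); first by rewrite ler_pM ?sqr_ge0.
rewrite -subr_ge0.
have -> : (a * c * ((rb * v2 + B) / 2)) ^+ 2 - rb * c ^+ 2 * B * (a ^+ 2 * v2)
  = (a * c * (rb * v2 - B) / 2) ^+ 2 by field.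
exact: sqr_ge0.
Qed.

(** Each monomial contains two factors of size [W], where [d], the variation of the squared sound
    speed, counts as one; the others are bounded coefficients. The constants count monomials: 3 with
    [vt], 9 + 3 = 12 from transport and sound speed, 3 + 3 = 6 in each of the last two groups. *)
Lemma source_bound (K W rb pb bb it : R) (s p r d : R) (v vt gr gp : 'I_3 -> R)
  (gv : 'I_3 -> 'I_3 -> R) : 0 <= K -> 0 <= W -> 0 < rb -> 0 < pb -> 0 < bb -> 0 < it ->
  `|s| <= W -> `|p| <= W -> (forall i, `|v i| <= W) -> `|r| <= K ->
  `|d| <= K * W -> (forall i, `|vt i| <= K) -> (forall i, `|gr i| <= K) ->
  (forall i, `|gp i| <= K) -> (forall i j, `|gv i j| <= K) ->
  `|\sum_(i < 3) v i * (- (s * vt i) - r * (\sum_(k < 3) v k * gv i k) - d * gr i)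
    + pb / rb * s * (- (s * \sum_(k < 3) gv k k) - \sum_(k < 3) v k * gr k)
    + p / bb * (- (p * \sum_(k < 3) gv k k) - (\sum_(k < 3) v k * gp k) - it * p)|
  <= (3 * K + 12 * K ^+ 2 + 6 * K * (pb / rb) + (6 * K + it) / bb) * W ^+ 2.
Proof.
move=> K0 W0 rb0 pb0 bb0 it0 hs hp hv hr hd hvt hgr hgp hgv.
have hit : `|it| <= it by rewrite gtr0_norm.
have hbb : `|bb^-1| <= bb^-1 by rewrite gtr0_norm ?invr_gt0.
have hrb : `|pb / rb| <= pb / rb by rewrite gtr0_norm ?divr_gt0.
rewrite !sum3; apply: le_trans.
  (* The upper bound is still an existential variable and is synthesised along the syntax of the
     left-hand side. *)
  repeat first [exact: hs | exact: hp | exact: hv | exact: hr | exact: hd | exact: hvt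
    | exact: hgr | exact: hgp | exact: hgv | exact: hit | exact: hbb | exact: hrb
    | apply: ler_normD_bound | apply: ler_normM_bound | apply: ler_normN_bound].
rewrite le_eqVlt; apply/orP; left; apply/eqP; field.
by rewrite !gt_eqF.
Qed.

End cone_algebra.

Section finite_speed.
Variable R : realType.
Local Notation V := 'rV[R]_3.

(** The system with divergences expanded by the product rule and the squared sound speed in closed
    form, at interior times, where field derivatives are two-sided. *)
Record field_solution (A gamma tau zeta T : R) (rho : fld T) (v : 'I_3 -> fld T)
    (Pi : fld T) : Prop := FieldSolution {
  density_gt0 : forall t x, 0 <= t <= T -> 0 < fv rho t x;
  mass_eq : forall t x, 0 < t < T -> ft rho t x
    + \sum_(k < 3) (fv rho t x * fx (v k) k t x + fv (v k) t x * fx rho k t x) = 0;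
  momentum_eq : forall i t x, 0 < t < T -> fv rho t x * ft (v i) t x
    + fv rho t x * (\sum_(k < 3) fv (v k) t x * fx (v i) k t x)
    + A * gamma * fv rho t x `^ (gamma - 1) * fx rho i t x + fx Pi i t x = 0;
  bulk_eq : forall t x, 0 < t < T -> tau * ft Pi t x
    + tau * (\sum_(k < 3) (fv (v k) t x * fx Pi k t x + fv Pi t x * fx (v k) k t x))
    + fv Pi t x + zeta * (\sum_(k < 3) fx (v k) k t x) = 0 }.

Definition sqpos (u : R) : R := Num.max 0 u ^+ 2.

Lemma max0_continuous : continuous (fun u : R => Num.max 0 u).
Proof.
move=> u; apply: (@continuous_max _ _ (fun _ : R => 0 : R) id).
  exact: cst_continuous.
exact: cvg_id.
Qed.

(** At u = 0 the difference quotient is max(0, h), which tends to 0: squaring removes the corner of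
    the positive part. *)
Lemma sqpos_derive (u : R) : is_derive u 1 sqpos (2 * Num.max 0 u).
Proof.
have [u0|u0|->] := ltgtP u 0.
- rewrite mulr0.
  apply: (@near_eq_is_derive _ _ _ (fun=> 0)).
  near=> x; rewrite /sqpos (max_idPl _) ?expr0n//; apply: ltW; near: x.
  exact: lt_nbhsl.
- apply: (@near_eq_is_derive _ _ _ (fun x : R => x ^+ 2)).
    near=> x; rewrite /sqpos (max_idPr _)//; apply: ltW; near: x.
    exact: lt_nbhsr.
  by apply: is_derive_eq; rewrite /GRing.scale/=; ring.
- rewrite mulr0.
  have h : (fun h : R => h^-1 *: ((sqpos \o shift 0) (h *: 1) - sqpos 0)) @ 0^' --> (0 : R).
    have cm : (fun h : R => Num.max 0 h) @ 0^' --> (0 : R).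
      apply: cvg_within_filter; have := @max0_continuous (0 : R).
      by rewrite /continuous_at maxxx.
    apply: cvg_trans cm; apply: near_eq_cvg; near=> h.
    have h0 : h != 0 by near: h; exact: nbhs_dnbhs_neq.
    rewrite /sqpos /= addr0 maxxx expr0n/= subr0 /GRing.scale/= mulr1.
    by have [h1|h1] := leP h 0; [rewrite expr0n/= mulr0|rewrite expr2 mulKf].
  by split; [apply/cvg_ex; exists 0|apply/cvg_lim].
Unshelve. all: by end_near. Qed.


Lemma forall_ord3 (P : 'I_3 -> Prop) : P 0 -> P 1 -> P 2%:R -> forall i, P i.
Proof.
move=> P0 P1 P2 [[|[|[|//]]] ilt].
- by have -> : Ordinal ilt = 0 by exact: val_inj.
- by have -> : Ordinal ilt = 1 by exact: val_inj.
- by have -> : Ordinal ilt = 2%:R by exact: val_inj.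
Qed.

Lemma common_bound3 (P : 'I_3 -> R -> Prop) :
  (forall i x y, P i x -> x <= y -> P i y) ->
  (forall i, exists2 M, 0 <= M & P i M) -> exists2 M, 0 <= M & forall i, P i M.
Proof.
move=> mono h; have [a a0 Pa] := h 0; have [b b0 Pb] := h 1; have [c c0 Pc] := h 2%:R.
exists (a + b + c); first by rewrite !addr_ge0.
by apply: forall_ord3; [apply: mono Pa _|apply: mono Pb _|apply: mono Pc _]; lra.
Qed.

Lemma slab_bounded3 T L (F : 'I_3 -> R -> V -> R) : (forall i, slab_continuous T (F i)) ->
  exists2 M, 0 <= M & forall i t x, 0 <= t <= T -> `|x| <= L -> `|F i t x| <= M.
Proof.
move=> cF; apply: common_bound3.
  by move=> i x y h xy t z tT zL; exact: le_trans (h t z tT zL) xy.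
by move=> i; exact: slab_bounded.
Qed.

(** * Weighted energy on one backward cone *)

Section cone.
Variables (A gamma tau zeta T rb c r : R) (xs : V).
Variables (rho : fld T) (v : 'I_3 -> fld T) (Pi : fld T).
Hypotheses (hA : 0 < A) (hgamma : 1 < gamma) (htau : 0 < tau) (hzeta : 0 < zeta).
Hypotheses (T0 : 0 < T) (rb0 : 0 < rb) (c0 : 0 <= c) (crT : c * T < r).
Hypothesis sol : field_solution A gamma tau zeta rho v Pi.
Let pb := A * gamma * rb `^ (gamma - 1).
Let bb := zeta / tau.
Hypothesis c2 : c ^+ 2 = pb + bb / rb.

Let pb0 : 0 < pb.
Proof.
have g0 : 0 < gamma by exact: lt_trans hgamma.
by apply: mulr_gt0; [exact: mulr_gt0|exact: powR_gt0].
Qed.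

Let bb0 : 0 < bb. Proof. exact: divr_gt0. Qed.

Let sg := fadd rho (fcst T (- rb)).
Let en := fadd (fadd
  (fmul (fcst T (rb / 2))
    (fadd (fadd (fmul (v 0) (v 0)) (fmul (v 1) (v 1))) (fmul (v 2%:R) (v 2%:R))))
  (fmul (fcst T (pb / (2 * rb))) (fmul sg sg)))
  (fmul (fcst T (2 * bb)^-1) (fmul Pi Pi)).
(** Linearised total pressure; its product with the velocity is the energy flux. *)
Let qf := fadd (fmul (fcst T pb) sg) Pi.
Let yf i := fadd (fcoord T i) (fcst T (- xs 0 i)).
Let rt := fadd (fcst T r) (fmul (fcst T (- c)) (ftime T)).
Let psi := fadd (fmul rt rt) (fmul (fcst T (- 1))
  (fadd (fadd (fmul (yf 0) (yf 0)) (fmul (yf 1) (yf 1))) (fmul (yf 2%:R) (yf 2%:R)))).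
Let phi := @fcomp R T (ltW T0) psi sqpos (fun u => 2 * Num.max 0 u)
  (fun t x _ => sqpos_derive _)
  (fun t x _ => cvgM (cvg_cst (2 : R)) (@max0_continuous (fv psi t x))).

Let enE t x : fv en t x = rb / 2 * (fv (v 0) t x ^+ 2 + fv (v 1) t x ^+ 2 + fv (v 2%:R) t x ^+ 2)
  + pb / (2 * rb) * (fv rho t x - rb) ^+ 2 + fv Pi t x ^+ 2 / (2 * bb).
Proof. by rewrite /= -!expr2; congr (_ + _); rewrite mulrC. Qed.

Let G t x := ft en t x + \sum_(i < 3) (fv qf t x * fx (v i) i t x + fv (v i) t x * fx qf i t x).

(* The constant-coefficient energy balance leaves only terms quadratic in the
   perturbation. *)
Let GE t x : 0 < t < T -> G t x =
  \sum_(i < 3) fv (v i) t x * (- ((fv rho t x - rb) * ft (v i) t x)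
     - fv rho t x * (\sum_(k < 3) fv (v k) t x * fx (v i) k t x)
     - (A * gamma * fv rho t x `^ (gamma - 1) - pb) * fx rho i t x)
  + pb / rb * (fv rho t x - rb) * (- ((fv rho t x - rb) * \sum_(k < 3) fx (v k) k t x)
     - \sum_(k < 3) fv (v k) t x * fx rho k t x)
  + fv Pi t x / bb * (- (fv Pi t x * \sum_(k < 3) fx (v k) k t x)
     - (\sum_(k < 3) fv (v k) t x * fx Pi k t x) - tau^-1 * fv Pi t x).
Proof.
move=> tT.
have taun : tau != 0 by rewrite gt_eqF.
have rbn : rb != 0 by rewrite gt_eqF. have bbn : bb != 0 by rewrite gt_eqF.
have e1 : - ((fv rho t x - rb) * \sum_(k < 3) fx (v k) k t x)
     - \sum_(k < 3) fv (v k) t x * fx rho k t x = ft rho t x + rb * \sum_(k < 3) fx (v k) k t x.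
  have h := mass_eq sol x tT; rewrite !sum3 in h *.
  (* The zero on the right is replaced by the left side of the mass equation, which leaves a
     polynomial identity. *)
  by apply/eqP; rewrite -subr_eq0; apply/eqP; rewrite -[RHS]oppr0 -[in RHS]h; ring.
have e2 i : - ((fv rho t x - rb) * ft (v i) t x)
     - fv rho t x * (\sum_(k < 3) fv (v k) t x * fx (v i) k t x)
     - (A * gamma * fv rho t x `^ (gamma - 1) - pb) * fx rho i t x
  = rb * ft (v i) t x + pb * fx rho i t x + fx Pi i t x.
  have h := momentum_eq sol i x tT; rewrite !sum3 in h *.
  by apply/eqP; rewrite -subr_eq0; apply/eqP; rewrite -[RHS]oppr0 -[in RHS]h; ring.
have e3 : - (fv Pi t x * \sum_(k < 3) fx (v k) k t x)
     - (\sum_(k < 3) fv (v k) t x * fx Pi k t x) - tau^-1 * fv Pi t x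
  = ft Pi t x + bb * \sum_(k < 3) fx (v k) k t x.
  have h := bulk_eq sol x tT; rewrite !sum3 in h *.
  apply/eqP; rewrite -subr_eq0; apply/eqP; rewrite -[RHS](mulr0 (- tau^-1)) -[in RHS]h /bb.
  by field.
rewrite e1 e3; under eq_bigr do rewrite e2.
rewrite /G !sum3 /=; field.
by rewrite rbn bbn.
Qed.

Let L := r + `|xs|.

Let r0 : 0 < r.
Proof. by apply: le_lt_trans crT; apply: mulr_ge0 => //; exact: ltW. Qed.

Let rt_ge0 t : 0 <= t <= T -> 0 <= r - c * t <= r.
Proof.
move=> /andP[t0 tT]; rewrite gerBl mulr_ge0// andbT subr_ge0.
by rewrite (le_trans (ler_wpM2l c0 tT))// ltW.
Qed.

Let psiE t x : fv psi t x = (r - c * t) ^+ 2 - sqnorm (x - xs).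
Proof. by rewrite /sqnorm sum3 !mxE /=; ring. Qed.

Let phi_supp t x : 0 <= t <= T -> L <= `|x| -> fv psi t x <= 0.
Proof.
move=> tT Lx; rewrite psiE subr_le0.
have h : r <= `|x - xs|.
  by have := lerB_dist x xs; rewrite /L in Lx; lra.
have [|i hi] := @mx_norm_neq0 _ _ _ (x - xs).
  by rewrite -[mx_norm _]/(`|x - xs|) gt_eqF// (lt_le_trans r0).
have h1 : r ^+ 2 <= sqnorm (x - xs).
  rewrite -[mx_norm _]/(`|x - xs|) in hi.
  apply: (@le_trans _ _ (`|x - xs| ^+ 2)); first by rewrite ler_pXn2r ?nnegrE// ltW.
  rewrite hi real_normK ?num_real// /sqnorm (bigD1 i.2)//= (ord1 i.1) lerDl.
  by rewrite sumr_ge0// => j _; rewrite sqr_ge0.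
apply: le_trans h1; have /andP[h2 h3] := rt_ge0 tT.
by rewrite ler_pXn2r ?nnegrE// ltW.
Qed.

Let en_ge0 t x : 0 <= fv en t x.
Proof.
have [rb1 pb1 bb1] : [/\ 0 <= rb, 0 <= pb & 0 <= bb] by split; exact: ltW.
rewrite enE; apply: addr_ge0; first apply: addr_ge0.
- by apply: mulr_ge0; [exact: divr_ge0|rewrite !addr_ge0 ?sqr_ge0].
- by apply: mulr_ge0; [apply: divr_ge0 => //; exact: mulr_ge0|exact: sqr_ge0].
- by apply: divr_ge0; [exact: sqr_ge0|exact: mulr_ge0].
Qed.

Let phi_ge0 t x : 0 <= fv phi t x. Proof. exact: sqr_ge0. Qed.

Let f := fmul phi en.
Let q i := fmul phi (fmul qf (v i)).

(** On a compact set the derivatives are bounded and the density stays away from 0, so the sound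
    speed is Lipschitz in the density; every perturbation is bounded by a multiple of the square
    root of the energy. *)
Let G_bound : exists2 C, 0 <= C & forall t x, 0 < t < T -> `|x| <= L ->
  `|G t x| <= C * fv en t x.
Proof.
have T0' := ltW T0.
have [Mr Mr0 hMr] := slab_bounded L (fv_cont rho).
have [Mi Mi0 hMi] : exists2 M, 0 <= M & forall t x, 0 <= t <= T -> `|x| <= L ->
    `|(fv rho t x)^-1| <= M.
  apply: (@slab_bounded _ _ (fun t x => (fv rho t x)^-1)).
  apply: (@slab_continuous_comp _ _ T0' (fv rho) GRing.inv); first exact: fv_cont.
  by move=> t x tT; apply: inv_continuous; rewrite gt_eqF// (density_gt0 sol).
have [Mvt Mvt0 hMvt] := @slab_bounded3 T L (fun i => ft (v i)) (fun i => ft_cont (v i)).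
have [Mgr Mgr0 hMgr] := @slab_bounded3 T L (fx rho) (fx_cont rho).
have [Mgp Mgp0 hMgp] := @slab_bounded3 T L (fx Pi) (fx_cont Pi).
have [Mgv Mgv0 hMgv] : exists2 M, 0 <= M & forall i j t x, 0 <= t <= T -> `|x| <= L ->
    `|fx (v i) j t x| <= M.
  apply: common_bound3.
    by move=> i x y h xy j t z tT zL; exact: le_trans (h j t z tT zL) xy.
  by move=> i; exact: slab_bounded3 (fx_cont (v i)).
(* [m, M] contains [rb] and all densities on the compact set. [Mi] bounds 1 / rho and might be 0,
   hence the 1 added. *)
pose m := Num.min rb (Mi + 1)^-1; pose M := rb + Mr.
have Mi1 : 0 < Mi + 1 by lra.
have m0 : 0 < m by rewrite lt_min rb0 invr_gt0.
have [K1 K10 hK1] := powR_lipschitz (gamma - 1) M m0.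
have Ag0 : 0 <= A * gamma by rewrite mulr_ge0// ltW// (lt_trans _ hgamma).
have AK0 : 0 <= A * gamma * K1 by exact: mulr_ge0.
(* The summand 0 only gives the sum the shape of [le_addends3]. *)
pose K := (Mr + Mvt + Mgr) + (Mgp + Mgv + A * gamma * K1) + 0.
have [q1 q2 q3] := le_addends3 Mr0 Mvt0 Mgr0.
have [q4 q5 q6] := le_addends3 Mgp0 Mgv0 AK0.
have [q7 q8 K0] := le_addends3 (le_trans Mr0 q1) (le_trans Mgp0 q4) (lexx 0).
(* Sum of the reciprocals of the three coefficients of the energy: each squared perturbation is at
   most [N] times the energy. *)
pose N := 2 / rb + 2 * rb / pb + 2 * bb.
have n1 : 0 <= 2 / rb by rewrite divr_ge0// ltW.
have n2 : 0 <= 2 * rb / pb by apply: divr_ge0; [apply: mulr_ge0 => //|]; exact: ltW.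
have n3 : 0 <= 2 * bb by apply: mulr_ge0 => //; exact: ltW.
have [N1 N2 N3] := le_addends3 n1 n2 n3.
have N0 : 0 <= N := le_trans n1 N1.
pose C1 := 3 * K + 12 * K ^+ 2 + 6 * K * (pb / rb) + (6 * K + tau^-1) / bb.
have C10 : 0 <= C1.
  have h1 : 0 <= K ^+ 2 by exact: sqr_ge0.
  have h2 : 0 <= K * (pb / rb) by apply: mulr_ge0 => //; apply: divr_ge0; exact: ltW.
  have h3 : 0 <= (6 * K + tau^-1) / bb.
    apply: divr_ge0; last exact: ltW.
    by apply: addr_ge0; [exact: mulr_ge0|rewrite invr_ge0 ltW].
  have h4 : 0 <= 6 * K * (pb / rb) by rewrite -mulrA mulr_ge0.
  have h5 : 0 <= 3 * K by exact: mulr_ge0.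
  have h6 : 0 <= 12 * K ^+ 2 by exact: mulr_ge0.
  exact: (addr_ge0 (addr_ge0 (addr_ge0 h5 h6) h4) h3).
exists (C1 * N); first exact: mulr_ge0.
move=> t x tT xL.
have tT' : 0 <= t <= T by case/andP: tT => *; rewrite !ltW.
pose W := Num.sqrt (N * fv en t x).
have W2 : W ^+ 2 = N * fv en t x by rewrite sqr_sqrtr// mulr_ge0.
have leW (a : R) : a ^+ 2 <= N * fv en t x -> `|a| <= W.
  by move=> h; rewrite -sqrtr_sqr ler_wsqrtr.
have rbn : rb != 0 by rewrite gt_eqF. have bbn : bb != 0 by rewrite gt_eqF.
have pbn : pb != 0 by rewrite gt_eqF.
have part (k z a : R) : 0 <= k -> k <= N -> z = k * a -> a <= fv en t x ->
    z <= N * fv en t x.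
  move=> k0 kN -> ae; apply: (@le_trans _ _ (k * fv en t x)); first exact: ler_wpM2l.
  exact: ler_wpM2r.
pose v2 := fv (v 0) t x ^+ 2 + fv (v 1) t x ^+ 2 + fv (v 2%:R) t x ^+ 2.
have [s0 s1 s2] : [/\ 0 <= fv (v 0) t x ^+ 2, 0 <= fv (v 1) t x ^+ 2 & 0 <= fv (v 2%:R) t x ^+ 2].
  by split; exact: sqr_ge0.
have [v20 v21 v22] := le_addends3 s0 s1 s2.
have p1 : 0 <= rb / 2 * v2.
  by apply: mulr_ge0; [apply: divr_ge0 => //; exact: ltW|exact: le_trans v20].
have p2 : 0 <= pb / (2 * rb) * (fv rho t x - rb) ^+ 2.
  apply: mulr_ge0; last exact: sqr_ge0.
  by apply: divr_ge0; [exact: ltW|apply: mulr_ge0 => //; exact: ltW].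
have p3 : 0 <= fv Pi t x ^+ 2 / (2 * bb) by apply: divr_ge0 => //; exact: sqr_ge0.
have := le_addends3 p1 p2 p3; rewrite -enE => -[en1 en2 en3].
have hs : `|fv rho t x - rb| <= W.
  apply: leW; apply: (part (2 * rb / pb) _ (pb / (2 * rb) * (fv rho t x - rb) ^+ 2)) => //.
  by field; rewrite rbn pbn.
have hp : `|fv Pi t x| <= W.
  apply: leW; apply: (part (2 * bb) _ (fv Pi t x ^+ 2 / (2 * bb))) => //.
  by field; rewrite bbn.
have hv2 : v2 <= N * fv en t x.
  apply: (part (2 / rb) _ (rb / 2 * v2)) => //.
  by field; rewrite rbn.
have hv i : `|fv (v i) t x| <= W.
  by apply: leW; apply: le_trans hv2; move: i; exact: forall_ord3.
have W0 : 0 <= W by exact: sqrtr_ge0.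
have hd : `|A * gamma * fv rho t x `^ (gamma - 1) - pb| <= K * W.
  have -> : A * gamma * fv rho t x `^ (gamma - 1) - pb
    = A * gamma * (fv rho t x `^ (gamma - 1) - rb `^ (gamma - 1)) by rewrite /pb; ring.
  rewrite normrM (ger0_norm Ag0).
  apply: (@le_trans _ _ (A * gamma * (K1 * `|fv rho t x - rb|))).
    apply: ler_wpM2l => //; have rp := density_gt0 sol x tT'.
    apply: hK1; apply/andP; split.
    - rewrite /m ge_min; apply/orP; right.
      rewrite -[leRHS]invrK lef_pV2 ?posrE ?invr_gt0//.
      apply: le_trans (le_trans (ler_norm _) (hMi t x tT' xL)) _; by rewrite lerDl.
    - apply: le_trans (le_trans (ler_norm _) (hMr t x tT' xL)) _.
      by rewrite /M lerDr ltW.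
    - by rewrite /m ge_min lexx.
    - by rewrite /M lerDl.
  by rewrite mulrA; apply: ler_pM => //; exact: le_trans q8.
have -> : C1 * N * fv en t x = C1 * W ^+ 2 by rewrite W2 mulrA.
rewrite GE//.
apply: source_bound => //.
- by rewrite invr_gt0.
- by apply: le_trans (hMr t x tT' xL) (le_trans q1 q7).
- by move=> i; apply: le_trans (hMvt i t x tT' xL) (le_trans q2 q7).
- by move=> i; apply: le_trans (hMgr i t x tT' xL) (le_trans q3 q7).
- by move=> i; apply: le_trans (hMgp i t x tT' xL) (le_trans q4 q8).
- by move=> i j; apply: le_trans (hMgv i j t x tT' xL) (le_trans q5 q8).
Qed.

(* The weight shrinks at speed [c], so the decrease of [phi] absorbs the flux
   of the energy through its level sets. *)
Let source_le : exists2 C, 0 <= C & forall t x, 0 < t < T ->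
  ft f t x + \sum_(i < 3) fx (q i) i t x <= C * fv f t x.
Proof.
have [C C0 hC] := G_bound; exists C => // t x tT.
have tT' : 0 <= t <= T by case/andP: tT => *; rewrite !ltW.
pose m := Num.max 0 (fv psi t x).
have m0 : 0 <= m by rewrite le_max lexx.
pose Y := (x 0 0 - xs 0 0) * fv (v 0) t x + (x 0 1 - xs 0 1) * fv (v 1) t x
  + (x 0 2%:R - xs 0 2%:R) * fv (v 2%:R) t x.
have -> : ft f t x + \sum_(i < 3) fx (q i) i t x =
    m ^+ 2 * G t x - 4 * m * ((r - c * t) * c * fv en t x + fv qf t x * Y).
  have e1 : ft psi t x = - 2 * c * (r - c * t) by rewrite /=; ring.
  have e2 i : fx psi i t x = - 2 * (x 0 i - xs 0 i).
    by case: i => -[|[|[|//]]] ilt; rewrite /= /bump /=;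
      [have -> : Ordinal ilt = 0 by exact: val_inj|have -> : Ordinal ilt = 1 by exact: val_inj
      |have -> : Ordinal ilt = 2%:R by exact: val_inj]; rewrite /=; ring.
  have e3 : ft f t x = m ^+ 2 * ft en t x + fv en t x * (2 * m * ft psi t x) by [].
  have e4 i : fx (q i) i t x = m ^+ 2 * (fv qf t x * fx (v i) i t x + fv (v i) t x * fx qf i t x)
     + fv qf t x * fv (v i) t x * (2 * m * fx psi i t x) by [].
  rewrite /G e3 e1 !sum3 !e4 !e2 /Y; ring.
have -> : fv f t x = m ^+ 2 * fv en t x by [].
have [p0|p0] := leP (fv psi t x) 0.
  have -> : m = 0 by exact/max_idPl.
  by rewrite expr0n/= !mulr0 !mul0r mulr0 subr0.
have xL : `|x| <= L.
  by rewrite leNgt; apply/negP => /ltW /(phi_supp tT'); rewrite leNgt p0.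
have h1 : m ^+ 2 * G t x <= C * (m ^+ 2 * fv en t x).
  rewrite mulrCA; apply: ler_wpM2l; first exact: sqr_ge0.
  by apply: le_trans (hC t x tT xL); exact: ler_norm.
have h2 : 0 <= (r - c * t) * c * fv en t x + fv qf t x * Y.
  have /andP[h3 h4] := rt_ge0 tT'.
  (* Where the weight is positive, x is within Euclidean distance r - c t of xs, as the bound
     requires. *)
  have := @flux_bound R rb pb bb c (r - c * t) (fv rho t x - rb) (fv Pi t x) Y
    (sqnorm (x - xs)) (fv (v 0) t x ^+ 2 + fv (v 1) t x ^+ 2 + fv (v 2%:R) t x ^+ 2)
    rb0 pb0 bb0 h3 c0.
  rewrite -enE => h5.
  have : `|fv qf t x * Y| <= (r - c * t) * c * fv en t x.
    apply: h5.
    - by rewrite !addr_ge0 ?sqr_ge0.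
    - exact: c2.
    - by apply: le_trans (cauchy_schwarz3 _ _ _ _ _ _) _; rewrite /sqnorm sum3 !mxE.
    - by move: p0; rewrite psiE subr_gt0 => /ltW.
  rewrite ler_norml => /andP[h6 _]; lra.
have h3 : 0 <= 4 * m * ((r - c * t) * c * fv en t x + fv qf t x * Y) by rewrite !mulr_ge0.
by lra.
Qed.

(** The weighted energy starts at zero and stays zero by Gronwall. As c T < r, the weight is still
    positive at (T, xs), so the energy itself vanishes there, and with it each of its three
    squares. *)
Lemma cone_vanish :
  (forall x, sqnorm (x - xs) < r ^+ 2 ->
    [/\ fv rho 0 x = rb, forall i, fv (v i) 0 x = 0 & fv Pi 0 x = 0]) ->
  [/\ fv rho T xs = rb, forall i, fv (v i) T xs = 0 & fv Pi T xs = 0].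
Proof.
move=> init.
have phi0 t x : 0 <= t <= T -> L <= `|x| -> fv phi t x = 0.
  move=> tT Lx; have /max_idPl h := phi_supp tT Lx.
  have -> : fv phi t x = Num.max 0 (fv psi t x) ^+ 2 by [].
  by rewrite h expr0n.
have fs t : 0 <= t <= T -> csupp L (fv f t).
  move=> tT x Lx; have -> : fv f t x = fv phi t x * fv en t x by [].
  by rewrite phi0// mul0r.
have qs i t : 0 <= t <= T -> csupp L (fv (q i) t).
  move=> tT x Lx; have -> : fv (q i) t x = fv phi t x * fv (fmul qf (v i)) t x by [].
  by rewrite phi0// mul0r.
have [C C0 hC] := source_le.
(* The source is taken to be the left-hand side of the balance law, which then holds by
   reflexivity. *)
pose s t x := ft f t x + \sum_(i < 3) fx (q i) i t x.
have bal t (tT : 0 < t < T) := @balance R T L f q fs qs s (fun _ _ _ => erefl) t tT.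
have f0 t x : 0 <= fv f t x by exact: mulr_ge0.
have sI t : 0 <= t <= T -> int3able (fv f t).
  by move=> tT; exact: csupp_int3able (slice_continuous (fv_cont f) tT) (fs t tT).
have TT : 0 <= T <= T by rewrite lexx ltW.
have ET : int3 (fv f T) <= 0.
  apply: (@gronwall R (fun t => int3 (fv f t)) (fun t => int3 (s t)) C T) => //.
  - exact: (int3_slice_continuous T0 fs).
  - move=> t tT; have [sIt dt] := bal t tT; split => //.
    have tT' : 0 <= t <= T by case/andP: tT => *; rewrite !ltW.
    rewrite -int3Z; last exact: sI.
    by apply: le_int3 => //; [apply: int3ableZ; exact: sI|move=> x; exact: hC].
  - suff -> : fv f 0 = (fun=> 0) by rewrite int3_0.
    apply/funext => x; have [h|h] := leP (r ^+ 2) (sqnorm (x - xs)).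
      have -> : fv f 0 x = Num.max 0 (fv psi 0 x) ^+ 2 * fv en 0 x by [].
      have /max_idPl -> : fv psi 0 x <= 0 by rewrite psiE mulr0 subr0 subr_le0.
      by rewrite expr0n/= mul0r.
    have [h1 h2 h3] := init x h.
    have -> : fv f 0 x = fv phi 0 x * fv en 0 x by [].
    rewrite enE h1 !h2 h3 subrr expr0n/=.
    by rewrite !(mulr0, addr0, mul0r).
have fT : fv f T xs = 0.
  apply: (int3_eq0 (slice_continuous (fv_cont f) TT) (fs T TT)) => //.
  by apply/eqP; rewrite eq_le ET int3_ge0.
have phiT : 0 < fv phi T xs.
  have -> : fv phi T xs = Num.max 0 (fv psi T xs) ^+ 2 by [].
  rewrite exprn_gt0// lt_max; apply/orP; right.
  rewrite psiE subrr; have -> : sqnorm 0 = 0 :> R by rewrite /sqnorm sum3 !mxE; ring.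
  by rewrite subr0 exprn_gt0// subr_gt0.
have enT : fv en T xs = 0.
  have e : fv f T xs = fv phi T xs * fv en T xs by [].
  move/eqP: fT; rewrite e mulf_eq0 gt_eqF//=.
  by move/eqP.
move: enT; rewrite enE.
have [s0 s1 s2] : [/\ 0 <= fv (v 0) T xs ^+ 2, 0 <= fv (v 1) T xs ^+ 2 & 0 <= fv (v 2%:R) T xs ^+ 2].
  by split; exact: sqr_ge0.
have s3 := sqr_ge0 (fv rho T xs - rb); have s4 := sqr_ge0 (fv Pi T xs).
have k1 : 0 < rb / 2 by exact: divr_gt0.
have k2 : 0 < pb / (2 * rb) by apply: divr_gt0 => //; exact: mulr_gt0.
have k3 : 0 < (2 * bb)^-1 by rewrite invr_gt0; exact: mulr_gt0.
have t1 := mulr_ge0 (ltW k1) (addr_ge0 (addr_ge0 s0 s1) s2).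
have t2 := mulr_ge0 (ltW k2) s3; have t3 := mulr_ge0 s4 (ltW k3).
move=> e0.
have z (k a : R) : 0 < k -> k * a = 0 -> a = 0.
  by move=> k0 /eqP; rewrite mulf_eq0 gt_eqF//= => /eqP.
have sq0 (a : R) : a ^+ 2 = 0 -> a = 0 by move/eqP; rewrite sqrf_eq0 => /eqP.
have u1 : fv (v 0) T xs ^+ 2 + fv (v 1) T xs ^+ 2 + fv (v 2%:R) T xs ^+ 2 = 0.
  by apply: (z _ _ k1); lra.
have u2 : (fv rho T xs - rb) ^+ 2 = 0 by apply: (z _ _ k2); lra.
have u3 : fv Pi T xs ^+ 2 = 0 by apply: (z _ _ k3); lra.
have [h0 h1 h2] : [/\ fv (v 0) T xs = 0, fv (v 1) T xs = 0 & fv (v 2%:R) T xs = 0].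
  by split; apply: sq0; lra.
have h3 := sq0 _ u2; have h4 := sq0 _ u3.
split; [lra| |exact: h4].
exact: forall_ord3.
Qed.

End cone.

End finite_speed.

(** * Confinement of the perturbation to a growing ball *)

Section solution_support.
Variable R : realType.
Local Notation V := 'rV[R]_3.

Lemma enormD (x y : V) : enorm (x + y) <= enorm x + enorm y.
Proof.
have en2 (z : V) : enorm z ^+ 2 = sqnorm z.
  by rewrite sqr_sqrtr// sumr_ge0// => i _; exact: sqr_ge0.
have en0 (z : V) : 0 <= enorm z by exact: sqrtr_ge0.
rewrite -(@ler_pXn2r _ 2) ?nnegrE ?addr_ge0// sqrrD !en2.
have h : x 0 0 * y 0 0 + x 0 1 * y 0 1 + x 0 2%:R * y 0 2%:R <= enorm x * enorm y.
  apply: (le_trans (ler_norm _)).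
  rewrite -(@ler_pXn2r _ 2) ?nnegrE ?mulr_ge0// real_normK ?num_real// exprMn !en2 /sqnorm !sum3.
  exact: cauchy_schwarz3.
rewrite /sqnorm !sum3 !mxE mulr2n; lra.
Qed.

Lemma le_enorm (r : R) (x : V) : 0 <= r -> (r <= enorm x) = (r ^+ 2 <= sqnorm x).
Proof.
move=> r0; rewrite -[RHS](@ler_sqrt _ (r ^+ 2)) ?sqrtr_sqr ?ger0_norm//.
by rewrite sumr_ge0// => i _; exact: sqr_ge0.
Qed.

Lemma lt_enorm (r : R) (x : V) : 0 <= r -> (r < enorm x) = (r ^+ 2 < sqnorm x).
Proof.
move=> r0; have en0 : 0 <= enorm x by exact: sqrtr_ge0.
rewrite -(@ltr_pXn2r _ 2) ?nnegrE// sqr_sqrtr//.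
by rewrite sumr_ge0// => i _; exact: sqr_ge0.
Qed.

Lemma le_norm_enorm (x : V) : `|x| <= enorm x.
Proof.
have [->|x0] := eqVneq x 0; first by rewrite normr0 sqrtr_ge0.
have [|i hi] := @mx_norm_neq0 _ _ _ x.
  by rewrite -[mx_norm _]/(`|x|) normr_eq0.
rewrite -[mx_norm _]/(`|x|) in hi; rewrite hi -sqrtr_sqr ler_wsqrtr//.
rewrite (bigD1 i.2)//= (ord1 i.1) lerDl.
by rewrite sumr_ge0// => j _; rewrite sqr_ge0.
Qed.

Variables (A gamma tau zeta T : R).
Variables (rho : R -> V -> R) (v : R -> V -> V) (Pi : R -> V -> R).
Hypotheses (hA : 0 < A) (hgamma : 1 < gamma) (htau : 0 < tau) (hzeta : 0 < zeta).
Hypothesis T0 : 0 < T.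
Hypothesis sol : is_C1_solution A gamma tau zeta T rho v Pi.

Let hr : C1_slab T rho. Proof. by case: sol. Qed.
Let hv i : C1_slab T (fun t x => v t x 0 i). Proof. by case: sol. Qed.
Let hp : C1_slab T Pi. Proof. by case: sol. Qed.

Definition rho_fld : fld T := fld_of_C1 T0 hr.
Definition v_fld i : fld T := fld_of_C1 T0 (hv i).
Definition Pi_fld : fld T := fld_of_C1 T0 hp.

Lemma dx_mul (f g : fld T) i t x : 0 <= t <= T ->
  dx i (fun y => fv f t y * fv g t y) x = fv f t x * fx g i t x + fv g t x * fx f i t x.
Proof.
by move=> tT; have [_ h] := is_deriveM (fx_der f i x tT) (fx_der g i x tT); exact: h.
Qed.

Lemma solution_field_solution : field_solution A gamma tau zeta rho_fld v_fld Pi_fld.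
Proof.
case: sol => _ _ _ h.
have w t : 0 < t < T -> 0 <= t <= T by case/andP=> *; rewrite !ltW.
split.
- by move=> t x tT; have [] := h t x tT.
- move=> t x tT; have [_ h1 _ _] := h t x (w t tT); rewrite -[RHS]h1.
  have -> // : \sum_(i < 3) dx i (fun y => rho t y * v t y 0 i) x = \sum_(k < 3)
    (fv rho_fld t x * fx (v_fld k) k t x + fv (v_fld k) t x * fx rho_fld k t x).
  by apply: eq_bigr => k _; rewrite (dx_mul rho_fld (v_fld k))//; exact: w.
- move=> i t x tT; have [r0 _ h1 _] := h t x (w t tT); rewrite -[RHS](h1 i).
  by rewrite cs2E.
- move=> t x tT; have [_ _ _ h1] := h t x (w t tT); rewrite -[RHS]h1.
  have -> // : \sum_(i < 3) dx i (fun y => v t y 0 i * Pi t y) x = \sum_(k < 3)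
    (fv (v_fld k) t x * fx Pi_fld k t x + fv Pi_fld t x * fx (v_fld k) k t x).
  by apply: eq_bigr => k _; rewrite (dx_mul (v_fld k) Pi_fld)//; exact: w.
Qed.

Variables (R0 rb : R).
Hypotheses (hR0 : 0 < R0) (hrb : 0 < rb).
Hypothesis hext : forall x, R0 <= enorm x -> [/\ rho 0 x = rb, v 0 x = 0 & Pi 0 x = 0].
Let c := cvbar A gamma tau zeta rb.

Lemma cvbar_sqr : c ^+ 2 = A * gamma * rb `^ (gamma - 1) + zeta / tau / rb.
Proof.
have g0 : 0 < gamma by exact: lt_trans hgamma.
rewrite /c /cvbar sqr_sqrtr; last first.
  apply: addr_ge0; apply: ltW; first by apply: mulr_gt0; [exact: mulr_gt0|exact: powR_gt0].
  by apply: divr_gt0 => //; exact: mulr_gt0.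
by congr (_ + _); field; rewrite !gt_eqF.
Qed.

(** For t > 0 the cone estimate is applied on [0, t], with the base of the cone centred at x; at t =
    0 the initial data answer directly. *)
Lemma solution_support t x : 0 <= t <= T -> R0 + c * t < enorm x ->
  [/\ rho t x = rb, v t x = 0 & Pi t x = 0].
Proof.
move=> /andP[t0 tT] hx.
have c0 : 0 <= c by exact: sqrtr_ge0.
have [t00|tp] := leP t 0.
  have -> : t = 0 by apply/eqP; rewrite eq_le t00 t0.
  by apply: hext; rewrite ltW// (le_lt_trans _ hx)// lerDl mulr_ge0.
(* By the triangle inequality the ball of this radius about x lies where the data are constant, and
   the hypothesis on x says exactly c t < r. *)
pose r := enorm x - R0.
have crt : c * t < r by rewrite /r; lra.
have fs := solution_field_solution.
have t0' := ltW tp.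
have fs' : field_solution A gamma tau zeta (frestr t0' tT rho_fld)
   (fun i => frestr t0' tT (v_fld i)) (frestr t0' tT Pi_fld).
  have w s : 0 < s < t -> 0 < s < T by move=> /andP[-> /= h]; exact: lt_le_trans tT.
  have w' s : 0 <= s <= t -> 0 <= s <= T by move=> /andP[-> /= h]; exact: le_trans tT.
  split.
  - by move=> s y st; exact: (density_gt0 fs y (w' s st)).
  - by move=> s y st; exact: (mass_eq fs y (w s st)).
  - by move=> i s y st; exact: (momentum_eq fs i y (w s st)).
  - by move=> s y st; exact: (bulk_eq fs y (w s st)).
have init y : sqnorm (y - x) < r ^+ 2 ->
    [/\ rho 0 y = rb, forall i, v 0 y 0 i = 0 & Pi 0 y = 0].
  move=> hy.
  have hy' : R0 <= enorm y.
    have e : enorm x <= enorm y + enorm (x - y).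
      by apply: le_trans (enormD _ _); rewrite addrC subrK.
    have : enorm (y - x) <= r.
      rewrite -(@ger0_norm _ r); last by rewrite ltW// (le_lt_trans _ crt)// mulr_ge0.
      by rewrite -sqrtr_sqr ler_wsqrtr// ltW.
    have -> : enorm (y - x) = enorm (x - y).
      by congr Num.sqrt; apply: eq_bigr => i _; rewrite !mxE -sqrrN opprB.
    by rewrite /r; lra.
  by have [a1 a2 a3] := hext hy'; split => // i; rewrite a2 mxE.
have [h1 h2 h3] := cone_vanish hA hgamma htau hzeta tp hrb c0 crt fs' cvbar_sqr init.
split => //; apply/rowP => i; rewrite mxE; exact: h2.
Qed.

End solution_support.
(** * Virial inequality and blow-up *)

Section riccati.
Variable R : realType.

(** A convex function lies above its tangent. Taken at s = rb and integrated, the tangent becomes a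
    nonnegative multiple of the conserved excess mass. *)
Lemma pressure_tangent (A gamma r s : R) : 0 < A -> 1 < gamma -> 0 < r -> 0 < s ->
  A * gamma * s `^ (gamma - 1) * (r - s) <= pressure A gamma r - pressure A gamma s.
Proof.
move=> A0 g1 r0 s0.
have Ag : 0 <= A * gamma by rewrite ltW// mulr_gt0// (lt_trans _ g1).
have g0 : 0 <= gamma - 1 by lra.
have mono (x y : R) : 0 < x -> x <= y -> A * gamma * x `^ (gamma - 1) <= A * gamma * y `^ (gamma - 1).
  move=> x0 xy; apply: ler_wpM2l => //; apply: ge0_ler_powR => //; rewrite nnegrE; lra.
have mvt (x y : R) : 0 < x -> x <= y -> exists2 z, x <= z <= y &
    pressure A gamma y - pressure A gamma x = A * gamma * z `^ (gamma - 1) * (y - x).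
  move=> x0 xy.
  have [|||z hz e] := @MVT_segment _ (pressure A gamma) (fun z : R => A * gamma * z `^ (gamma - 1)) x y.
  - by [].
  - move=> z; rewrite in_itv/= => /andP[xz _]; apply: pressure_derive; lra.
  - apply: continuous_in_subspaceT => z /set_mem/= /[!in_itv]/= /andP[xz _].
    by apply: is_derive_continuous; apply: pressure_derive; lra.
  by exists z => //; rewrite in_itv/= in hz.
have [sr|/ltW rs] := leP s r.
  have [z /andP[sz zr] ->] := mvt s r s0 sr.
  by rewrite ler_wpM2r ?subr_ge0// mono.
have [z /andP[rz zs] e] := mvt r s r0 rs.
rewrite -[leRHS]opprB e -subr_ge0.
have -> : - (A * gamma * z `^ (gamma - 1) * (s - r)) - A * gamma * s `^ (gamma - 1) * (r - s)
  = (A * gamma * s `^ (gamma - 1) - A * gamma * z `^ (gamma - 1)) * (s - r) by ring.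
by rewrite mulr_ge0 ?subr_ge0// mono//; lra.
Qed.

Lemma derive0_cst (F : R -> R) (T : R) : {within `[0, T], continuous F} ->
  (forall t, 0 < t < T -> is_derive t 1 F 0) -> forall t, 0 <= t <= T -> F t = F 0.
Proof.
move=> cF dF t /andP[t0 tT]; apply/eqP; rewrite eq_le; apply/andP; split.
- apply: (@ler0_derive1_nincr _ F 0 T) => // s; rewrite in_itv/= => sT.
  + by have [] := dF s sT.
  + by rewrite derive1E; have [_ ->] := dF s sT.
- apply: (@ger0_derive1_ndecr _ F 0 T) => // s; rewrite in_itv/= => sT.
  + by have [] := dF s sT.
  + by rewrite derive1E; have [_ ->] := dF s sT.
Qed.

(** Separation of variables: F' / F^2 >= 1 / (a (r + c t)^5), and the right side has integral 1 / (4
    a c r^4) over t >= 0. The assumption on F(0) puts 1 / F(0) below that value, and the gap [d]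
    bounds r + c T. *)
Lemma riccati_bound (F F' : R -> R) (a c r T : R) : 0 < a -> 0 < c -> 0 < r -> 0 < T ->
  {within `[0, T], continuous F} ->
  (forall t, 0 < t < T -> [/\ is_derive t 1 F (F' t), 0 <= F' t
     & F t ^+ 2 <= a * (r + c * t) ^+ 5 * F' t]) ->
  4 * a * c * r ^+ 4 < F 0 ->
  T <= Num.max 1 (4 * a * c * ((4 * a * c * r ^+ 4)^-1 - (F 0)^-1))^-1 / c.
Proof.
move=> a0 c0 r0 T0 cF dF hF.
have ac0 : 0 < 4 * a * c by rewrite !mulr_gt0.
have k0 : 0 < 4 * a * c * r ^+ 4 by rewrite mulr_gt0 ?exprn_gt0.
have F00 : 0 < F 0 by exact: lt_trans hF.
have Fge t : 0 <= t <= T -> F 0 <= F t.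
  move=> /andP[t0 tT]; apply: (@ger0_derive1_ndecr _ F 0 T) => // s; rewrite in_itv/= => sT.
  + by have [[]] := dF s sT.
  + by rewrite derive1E; have [[_ ->]] := dF s sT.
have Fgt t : 0 <= t <= T -> 0 < F t by move=> tT; exact: lt_le_trans (Fge t tT).
pose rad t := r + c * t.
have rad0 t : 0 <= t -> 0 < rad t by move=> t0; rewrite /rad ltr_pwDl// mulr_ge0// ltW.
have drad (t : R) : is_derive t 1 rad c.
  by apply: is_derive_eq; rewrite /GRing.scale/=; ring.
(* [H] is a primitive of [F' / F ^+ 2 - (a * rad ^+ 5)^-1]. *)
pose H t := (4 * a * c)^-1 * (rad t ^+ 4)^-1 - (F t)^-1.
have dH t : 0 < t < T -> is_derive t 1 H
   ((4 * a * c)^-1 * (- (rad t ^+ 4) ^- 2 * (4 * rad t ^+ 3 * c)) - (- F t ^- 2 * F' t)).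
  move=> tT; have [dFt _ _] := dF t tT.
  have tT' : 0 <= t <= T by case/andP: tT => *; rewrite !ltW.
  have Fn : F t != 0 by rewrite gt_eqF// Fgt.
  have rn : rad t ^+ 4 != 0 by rewrite gt_eqF// exprn_gt0// rad0//; case/andP: tT'.
  have d4 : is_derive t 1 (fun t => rad t ^+ 4) (4 * rad t ^+ 3 * c).
    by apply: is_derive_eq; rewrite /GRing.scale/=; ring.
  have d1 : is_derive t 1 (fun t => (rad t ^+ 4)^-1) (- (rad t ^+ 4) ^- 2 *: (4 * rad t ^+ 3 * c)).
    exact: (@is_deriveV _ (fun t => rad t ^+ 4)).
  have d2 : is_derive t 1 (fun t => (F t)^-1) (- F t ^- 2 *: F' t) by exact: is_deriveV.
  by apply: is_derive_eq; rewrite /GRing.scale/=; ring.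
have H_ge : H 0 <= H T.
  apply: (@ger0_derive1_ndecr _ H 0 T) => //; last exact: ltW.
  - by move=> s; rewrite in_itv/= => /dH[].
  - move=> s; rewrite in_itv/= => sT; rewrite derive1E; have [_ ->] := dH s sT.
    have sT' : 0 <= s <= T by case/andP: sT => *; rewrite !ltW.
    have [_ _ h] := dF s sT.
    have r1 : 0 < rad s by apply: rad0; case/andP: sT'.
    have f1 := Fgt s sT'.
    have -> : (4 * a * c)^-1 * (- (rad s ^+ 4) ^- 2 * (4 * rad s ^+ 3 * c)) - (- F s ^- 2 * F' s)
       = (a * rad s ^+ 5 * F' s - F s ^+ 2) / (a * rad s ^+ 5 * F s ^+ 2).
      by field; rewrite !gt_eqF.
    by rewrite divr_ge0 ?subr_ge0// !mulr_ge0 ?exprn_ge0 ?ltW.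
  - apply/subspace_continuousP => x; rewrite /= in_itv/= => xT.
    move/subspace_continuousP: cF => /(_ x); rewrite /= in_itv/= => /(_ xT) cFx.
    apply: cvgB.
      apply: cvgM; first exact: cvg_cst.
      apply: cvg_within_filter; apply: cvgV.
        by rewrite gt_eqF// exprn_gt0// rad0//; case/andP: xT.
      apply: (@continuous_comp _ _ _ rad (fun y : R => y ^+ 4)); last exact: exprn_continuous.
      exact: is_derive_continuous (drad x).
    by apply: cvgV => //; rewrite gt_eqF// Fgt.
have TT : 0 <= T <= T by rewrite lexx ltW.
have radT := rad0 T (ltW T0).
pose d := (4 * a * c * r ^+ 4)^-1 - (F 0)^-1.
have d0 : 0 < d by rewrite subr_gt0 ltf_pV2.
have dle : d < (4 * a * c)^-1 * (rad T ^+ 4)^-1.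
  have e : H 0 = d by rewrite /H /d /rad mulr0 addr0 (invfM (4 * a * c)).
  rewrite -e; apply: (le_lt_trans H_ge); rewrite /H gtrDl oppr_lt0 invr_gt0 Fgt//.
have radB : rad T ^+ 4 <= (4 * a * c * d)^-1.
  have h4 : 0 < rad T ^+ 4 by exact: exprn_gt0.
  have h5 : 0 < 4 * a * c * d by exact: mulr_gt0.
  rewrite -[leLHS]invrK lef_pV2 ?posrE ?invr_gt0//.
  have := dle; rewrite -(ltr_pM2l ac0) mulVKf ?gt_eqF// => h.
  exact: ltW.
rewrite ler_pdivlMr// mulrC le_max.
(* This replaces a fourth root: beyond 1, c T is at most its fourth power, hence at most (r + c
   T)^4. *)
have [h|h] := leP (c * T) 1; first by [].
apply/orP; right; apply: le_trans radB.
have cT0 : 0 <= c * T by rewrite mulr_ge0// ltW.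
apply: (@le_trans _ _ ((c * T) ^+ 4)); first by rewrite ler_eXnr// ltW.
by rewrite ler_pXn2r ?nnegrE ?(ltW radT)// /rad; lra.
Qed.

End riccati.

(** * Conserved integrals and growth of the radial momentum *)

Section moments.
Variable R : realType.
Local Notation V := 'rV[R]_3.
Variables (A gamma tau zeta T R0 rb m : R).
Variables (rho : R -> V -> R) (v : R -> V -> V) (Pi : R -> V -> R).
Hypotheses (hA : 0 < A) (hgamma : 1 < gamma) (htau : 0 < tau) (hzeta : 0 < zeta).
Hypotheses (T0 : 0 < T) (hR0 : 0 < R0) (hrb : 0 < rb).
Hypothesis sol : is_C1_solution A gamma tau zeta T rho v Pi.
Hypothesis hext : forall x, R0 <= enorm x -> [/\ rho 0 x = rb, v 0 x = 0 & Pi 0 x = 0].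
Hypothesis hm : forall x, rho 0 x <= m.
Hypotheses (hM : 0 <= DeltaM rb rho 0) (hG : 0 <= Gint Pi 0).
Let c := cvbar A gamma tau zeta rb.
Let rf := rho_fld T0 sol.
Let vf i := v_fld T0 sol i.
Let pf := Pi_fld T0 sol.
Let fs : field_solution A gamma tau zeta rf vf pf := solution_field_solution T0 sol.
(** The margin 1 turns the strict exterior of the balls into the non-strict exterior that [csupp]
    asks for. *)
Let L := R0 + c * T + 1.
Let rad t := R0 + c * t.

Lemma cvbar_gt0 : 0 < c.
Proof.
rewrite sqrtr_gt0; apply: ltr_wpDl; last by apply: divr_gt0 => //; exact: mulr_gt0.
apply: mulr_ge0; last exact: powR_ge0.
by apply: mulr_ge0; apply: ltW => //; exact: lt_trans hgamma.
Qed.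

Let w t : 0 < t < T -> 0 <= t <= T. Proof. by case/andP=> *; rewrite !ltW. Qed.

Let rad_gt0 t : 0 <= t -> 0 < rad t.
Proof. by move=> t0; apply: ltr_pwDl => //; apply: mulr_ge0 => //; exact: ltW cvbar_gt0. Qed.

Let supp t x : 0 <= t <= T -> rad t < enorm x -> [/\ rho t x = rb, v t x = 0 & Pi t x = 0].
Proof. exact: solution_support hA hgamma htau hzeta T0 sol _ _ hrb hext t x. Qed.

Let suppL t x : 0 <= t <= T -> L <= `|x| -> [/\ rho t x = rb, v t x = 0 & Pi t x = 0].
Proof.
move=> tT Lx; apply: supp => //; apply: (@lt_le_trans _ _ L); last first.
  exact: le_trans (le_norm_enorm x).
have h : c * t <= c * T by apply: ler_wpM2l; [exact: ltW cvbar_gt0|case/andP: tT].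
by rewrite /rad /L; lra.
Qed.

Let sg := fadd rf (fcst T (- rb)).

Let sg_supp t : 0 <= t <= T -> csupp L (fv sg t).
Proof. by move=> tT x Lx; have [h _ _] := suppL tT Lx; rewrite /= h subrr. Qed.

Let vf_supp i t x : 0 <= t <= T -> L <= `|x| -> fv (vf i) t x = 0.
Proof. by move=> tT Lx; have [_ h _] := suppL tT Lx; rewrite /= h mxE. Qed.

Let pf_supp t : 0 <= t <= T -> csupp L (fv pf t).
Proof. by move=> tT x Lx; have [_ _ h] := suppL tT Lx. Qed.

Lemma mass_conservation t : 0 <= t <= T -> DeltaM rb rho t = DeltaM rb rho 0.
Proof.
apply: (@derive0_cst R (DeltaM rb rho)); first exact: (int3_slice_continuous T0 sg_supp).
move=> {}t tT.
have [||_ h] := @balance R T L sg (fun i => fmul rf (vf i)) sg_supp _ (fun _ _ => 0) _ t tT.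
- by move=> i s sT x Lx; have e := vf_supp i sT Lx; rewrite /= in e *; rewrite e mulr0.
- by move=> s x sT; rewrite /= addr0; exact: (mass_eq fs x sT).
- by move: h; rewrite int3_0.
Qed.

(** The terms Pi v and (zeta / tau) v are compactly supported fluxes, which leaves G' = - G / tau.
    Only the sign of G matters later, so Gronwall is applied to - G. *)
Lemma bulk_integral_ge0 t : 0 <= t <= T -> 0 <= Gint Pi t.
Proof.
move=> tT; rewrite -oppr_le0.
apply: (@gronwall R (fun t => - Gint Pi t) (fun t => tau^-1 * Gint Pi t) (- tau^-1) T) => //; last by rewrite oppr_le0.
  have h := int3_slice_continuous T0 pf_supp.
  by move=> x; apply: cvgN; exact: h.
move=> s sT.
have [||I h] := @balance R T L pf
  (fun k => fadd (fmul (vf k) pf) (fmul (fcst T (zeta / tau)) (vf k))) pf_supp _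
  (fun t x => - tau^-1 * Pi t x) _ s sT.
- move=> i u uT x Lx; have e := vf_supp i uT Lx; rewrite /= in e *.
  by rewrite e mul0r mulr0 addr0.
- move=> u x uT; have e := bulk_eq fs x uT.
  apply/eqP; rewrite -subr_eq0; apply/eqP; rewrite -[RHS](mulr0 tau^-1) -[in RHS]e !sum3 /=.
  by field; rewrite gt_eqF.
- split; last by lra.
  have -> : tau^-1 * Gint Pi s = - int3 (fun x => - tau^-1 * Pi s x).
    rewrite int3Z; first by rewrite mulNr opprK.
    exact: csupp_int3able (slice_continuous (fv_cont pf) (w sT)) (pf_supp (w sT)).
  exact: is_deriveN.
Qed.

Let prf := @fcomp R T (ltW T0) rf (pressure A gamma)
  (fun r => A * gamma * r `^ (gamma - 1))
  (fun t x tT => pressure_derive A gamma (density_gt0 fs x tT))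
  (fun t x tT => cvgM (cvg_cst (A * gamma))
     (is_derive_continuous (is_derive1_powR (gamma - 1) (density_gt0 fs x tT)))).
(** Subtracting the background pressure leaves gradients unchanged and gives the momentum flux [qm]
    compact support. *)
Let gf := fadd (fadd prf (fcst T (- pressure A gamma rb))) pf.
Let xv := fadd (fadd (fmul (fcoord T 0) (vf 0)) (fmul (fcoord T 1) (vf 1)))
  (fmul (fcoord T 2%:R) (vf 2%:R)).
Let mf := fmul xv rf.
Let qm k := fadd (fmul mf (vf k)) (fmul (fcoord T k) gf).

(** Trace of the stress tensor: rho v v plus the identity times P - P(rb) + Pi. *)
Let virial t x := rho t x * (v t x 0 0 ^+ 2 + v t x 0 1 ^+ 2 + v t x 0 2%:R ^+ 2)
  + 3 * (pressure A gamma (rho t x) - pressure A gamma rb + Pi t x).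

Let mf_supp t : 0 <= t <= T -> csupp L (fv mf t).
Proof.
move=> tT x Lx; have e i := vf_supp i tT Lx; rewrite /= in e *.
by rewrite !e !mulr0 !addr0 mul0r.
Qed.

Let qm_supp i t : 0 <= t <= T -> csupp L (fv (qm i) t).
Proof.
move=> tT x Lx; have e := vf_supp i tT Lx; have [e1 _ e2] := suppL tT Lx; rewrite /= in e *.
by rewrite e e1 e2 subrr addr0 !mulr0 addr0.
Qed.

Let momentum_balance t x : 0 < t < T ->
  ft mf t x + \sum_(i < 3) fx (qm i) i t x = virial t x.
Proof.
move=> tT; have h i := momentum_eq fs i x tT; have h0 := mass_eq fs x tT.
pose lhs i := fv rf t x * ft (vf i) t x
    + fv rf t x * (\sum_(k < 3) fv (vf k) t x * fx (vf i) k t x)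
    + A * gamma * fv rf t x `^ (gamma - 1) * fx rf i t x + fx pf i t x.
pose lhs0 := ft rf t x
    + \sum_(k < 3) (fv rf t x * fx (vf k) k t x + fv (vf k) t x * fx rf k t x).
(* The conservative form is the momentum equations weighted by the coordinates plus the mass
   equation weighted by x . v. *)
transitivity (virial t x + x 0 0 * lhs 0 + x 0 1 * lhs 1 + x 0 2%:R * lhs 2%:R + fv xv t x * lhs0).
  rewrite /lhs /lhs0 /virial !sum3.
  have d01 : (0 == 1 :> 'I_3) = false by []. have d02 : (0 == 2%:R :> 'I_3) = false by [].
  have d10 : (1 == 0 :> 'I_3) = false by []. have d12 : (1 == 2%:R :> 'I_3) = false by [].
  have d20 : (2%:R == 0 :> 'I_3) = false by []. have d21 : (2%:R == 1 :> 'I_3) = false by [].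
  cbn [fv ft fx qm mf xv gf prf fadd fmul fcst fcoord fcomp].
  rewrite !eqxx d01 d02 d10 d12 d20 d21.
  rewrite /=.
  (* [ring] is much faster on variables than on these large atoms. *)
  repeat match goal with
  | |- context [dx ?i ?g x] => generalize (dx i g x)
  | |- context [dt T ?g t x] => generalize (dt T g t x)
  | |- context [v t x ?i ?j] => generalize (v t x i j)
  | |- context [x ?i ?j] => generalize (x i j)
  | |- context [powR ?a ?b] => generalize (powR a b)
  end.
  move: (pressure A gamma (rho t x)) (pressure A gamma rb) (rho t x) (Pi t x) => *.
  ring.
by rewrite {}/lhs0 {}/lhs h0 !h !mulr0 !addr0.
Qed.

Let FE t : Fmom rho v t = int3 (fv mf t).
Proof. by congr int3; apply/funext => x; rewrite sum3 /=; ring. Qed.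

Let pb := A * gamma * rb `^ (gamma - 1).
Let vol (r : R) : R := 4 / 3 * pi * r ^+ 3.

(** On the ball this combines rho |v - lambda x|^2 >= 0, |x| <= rad t and the tangent inequality;
    outside it both sides vanish. The density is split as [sg] plus [rb] on the ball, so that the
    lower bound is a linear combination of quantities with controlled integrals. *)
Let virial_ge t lambda x : 0 <= t <= T ->
  2 * lambda * fv mf t x + ((3 * pb - lambda ^+ 2 * rad t ^+ 2) * fv sg t x
    + (- (lambda ^+ 2 * rad t ^+ 2 * rb) * ball_ind (rad t) x + 3 * Pi t x))
  <= virial t x.
Proof.
move=> tT.
have rho0 : 0 < rho t x := density_gt0 fs x tT.
have mfE : fv mf t x = (x 0 0 * v t x 0 0 + x 0 1 * v t x 0 1 + x 0 2%:R * v t x 0 2%:R) * rho t x by [].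
have sgE : fv sg t x = rho t x - rb by [].
rewrite mfE sgE /virial /ball_ind.
have [xr|xr] := leP (sqnorm x) (rad t ^+ 2).
  have h := pressure_tangent hA hgamma rho0 hrb; rewrite -/pb in h.
  have h1 : 0 <= rho t x * ((v t x 0 0 - lambda * x 0 0) ^+ 2 + (v t x 0 1 - lambda * x 0 1) ^+ 2
     + (v t x 0 2%:R - lambda * x 0 2%:R) ^+ 2).
    by apply: mulr_ge0; [exact: ltW|rewrite !addr_ge0 ?sqr_ge0].
  have h2 : 0 <= lambda ^+ 2 * rho t x * (rad t ^+ 2 - sqnorm x).
    by apply: mulr_ge0; [apply: mulr_ge0; [exact: sqr_ge0|exact: ltW]|rewrite subr_ge0].
  rewrite -subr_ge0 /=; rewrite /sqnorm sum3 in h2.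
  set lhs := (X in 0 <= X).
  have -> : lhs = rho t x * ((v t x 0 0 - lambda * x 0 0) ^+ 2 + (v t x 0 1 - lambda * x 0 1) ^+ 2
     + (v t x 0 2%:R - lambda * x 0 2%:R) ^+ 2)
    + lambda ^+ 2 * rho t x * (rad t ^+ 2 - (x 0 0 ^+ 2 + x 0 1 ^+ 2 + x 0 2%:R ^+ 2))
    + 3 * (pressure A gamma (rho t x) - pressure A gamma rb - pb * (rho t x - rb)).
    by rewrite /lhs; ring.
  by rewrite !addr_ge0// mulr_ge0// subr_ge0.
have [-> -> ->] : [/\ rho t x = rb, v t x = 0 & Pi t x = 0].
  apply: supp => //; have r0 : 0 < rad t by apply: rad_gt0; case/andP: tT.
  by rewrite lt_enorm// ltW.
by rewrite !mxE /=; lra.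
Qed.

Let rb_le_m : rb <= m.
Proof.
(* The point with all coordinates R0 has Euclidean norm at least R0, so the background density is
   one of the initial values. *)
have [<- _ _] : [/\ rho 0 (const_mx R0) = rb, v 0 (const_mx R0) = 0 & Pi 0 (const_mx R0) = 0]; last exact: hm.
apply: hext; rewrite le_enorm ?(ltW hR0)// /sqnorm.
by rewrite sum3 !mxE -addrA lerDl addr_ge0 ?sqr_ge0.
Qed.

Let mass_le : DeltaM rb rho 0 <= (m - rb) * vol R0.
Proof.
have [I e] := ball_volume hR0; rewrite /vol -e -int3Z//.
have T00 : 0 <= (0 : R) <= T by apply/andP; split => //; exact: ltW.
apply: le_int3.
- exact: csupp_int3able (slice_continuous (fv_cont sg) T00) (sg_supp T00).
- exact: int3ableZ.
- move=> x; rewrite /ball_ind; case: (leP (sqnorm x) (R0 ^+ 2)) => h.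
    by rewrite mulr1 lerD2r.
  have [-> _ _] : [/\ rho 0 x = rb, v 0 x = 0 & Pi 0 x = 0].
    by apply: hext; rewrite le_enorm ltW.
  by rewrite subrr mulr0.
Qed.

Lemma moment_derive t : 0 < t < T -> is_derive t 1 (Fmom rho v) (int3 (virial t)).
Proof.
move=> tT; have [_] := balance mf_supp qm_supp momentum_balance tT.
have -> : Fmom rho v = (fun t => int3 (fv mf t)) by apply/funext => s; exact: FE.
by [].
Qed.

(** Integral of the pointwise bound. The second moment of the density is at most (rad t)^2 times the
    mass in the ball, and that mass is at most m vol(rad t) by conservation and [mass_le]. [lambda]
    stays free, to be chosen by time. *)
Lemma moment_growth t lambda : 0 < t < T ->
  2 * lambda * Fmom rho v t - lambda ^+ 2 * (4 / 3 * pi * m * rad t ^+ 5) <= int3 (virial t).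
Proof.
move=> tT; have tT' := w tT.
have r0 : 0 < rad t by apply: rad_gt0; case/andP: tT'.
have [Iv _] := balance mf_supp qm_supp momentum_balance tT.
have [Ib Eb] := ball_volume r0.
have Is : int3able (fv sg t) by exact: csupp_int3able (slice_continuous (fv_cont sg) tT') (sg_supp tT').
have Ip : int3able (Pi t) by exact: csupp_int3able (slice_continuous (fv_cont pf) tT') (pf_supp tT').
have Im : int3able (fv mf t) by exact: csupp_int3able (slice_continuous (fv_cont mf) tT') (mf_supp tT').
have I1 := int3ableZ (2 * lambda) Im.
have I2 := int3ableZ (3 * pb - lambda ^+ 2 * rad t ^+ 2) Is.
have I3 := int3ableZ (- (lambda ^+ 2 * rad t ^+ 2 * rb)) Ib.
have I4 := int3ableZ 3 Ip.
have I34 := int3ableD I3 I4; have I234 := int3ableD I2 I34.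
have := le_int3 (int3ableD I1 I234) Iv (fun x => virial_ge lambda x tT').
rewrite (int3D I1 I234) (int3D I2 I34) (int3D I3 I4) !int3Z// Eb -FE.
apply: le_trans.
have hG' : 0 <= int3 (Pi t) := bulk_integral_ge0 tT'.
have eM : int3 (fv sg t) = DeltaM rb rho 0 by exact: mass_conservation.
rewrite eM.
have pb0 : 0 <= pb.
  by apply: mulr_ge0; [apply: mulr_ge0; apply: ltW => //; exact: lt_trans hgamma|exact: powR_ge0].
have h1 : 0 <= pb * DeltaM rb rho 0 by exact: mulr_ge0.
have volle : vol R0 <= vol (rad t).
  rewrite /vol; apply: ler_wpM2l; first by rewrite mulr_ge0// pi_ge0.
  have R0r : R0 <= rad t.
    by rewrite /rad lerDl; apply: mulr_ge0; [exact: ltW cvbar_gt0|case/andP: tT'].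
  by rewrite ler_pXn2r// nnegrE ltW.
have h2 : DeltaM rb rho 0 + rb * vol (rad t) <= m * vol (rad t).
  have : (m - rb) * vol R0 <= (m - rb) * vol (rad t) by apply: ler_wpM2l => //; rewrite subr_ge0.
  by have := mass_le; lra.
have h3 : lambda ^+ 2 * rad t ^+ 2 * (DeltaM rb rho 0 + rb * vol (rad t))
   <= lambda ^+ 2 * rad t ^+ 2 * (m * vol (rad t)).
  by apply: ler_wpM2l => //; apply: mulr_ge0; exact: sqr_ge0.
have -> : lambda ^+ 2 * (4 / 3 * pi * m * rad t ^+ 5) = lambda ^+ 2 * rad t ^+ 2 * (m * vol (rad t)).
  by rewrite /vol; ring.
rewrite -/(vol (rad t)) -subr_ge0.
set lhs := (X in 0 <= X).
have -> : lhs = (lambda ^+ 2 * rad t ^+ 2 * (m * vol (rad t))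
   - lambda ^+ 2 * rad t ^+ 2 * (DeltaM rb rho 0 + rb * vol (rad t)))
   + 3 * (pb * DeltaM rb rho 0) + 3 * int3 (Pi t) by rewrite /lhs; ring.
apply: addr_ge0; last exact: mulr_ge0.
by apply: addr_ge0; [rewrite subr_ge0|exact: mulr_ge0].
Qed.

Lemma existence_time_bound :
  4 * (4 / 3 * pi * m) * c * R0 ^+ 4 < Fmom rho v 0 ->
  T <= Num.max 1 (4 * (4 / 3 * pi * m) * c
    * ((4 * (4 / 3 * pi * m) * c * R0 ^+ 4)^-1 - (Fmom rho v 0)^-1))^-1 / c.
Proof.
move=> hF.
have m0 : 0 < m by exact: lt_le_trans rb_le_m.
have a0 : 0 < 4 / 3 * pi * m by apply: mulr_gt0 => //; apply: mulr_gt0 => //; exact: pi_gt0.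
apply: (riccati_bound (F' := fun t => int3 (virial t)) a0 cvbar_gt0 hR0 T0) hF.
  have -> : Fmom rho v = (fun t => int3 (fv mf t)) by apply/funext => s; exact: FE.
  exact: (int3_slice_continuous T0 mf_supp).
move=> t tT.
have r0 : 0 < rad t by apply: rad_gt0; case/andP: tT => *; exact: ltW.
split; first exact: moment_derive.
  (* The choice lambda = 0 gives monotonicity of F. *)
  by have := moment_growth 0 tT; rewrite expr0n/= !(mulr0, mul0r) subr0.
have ar : 0 < 4 / 3 * pi * m * rad t ^+ 5 by rewrite mulr_gt0// exprn_gt0.
set b := 4 / 3 * pi * m * rad t ^+ 5 in ar *.
(* This lambda maximises 2 lambda F - lambda^2 b, with maximum F^2 / b. *)
have := moment_growth (Fmom rho v t / b) tT; rewrite -/b.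
have -> : 2 * (Fmom rho v t / b) * Fmom rho v t - (Fmom rho v t / b) ^+ 2 * b = Fmom rho v t ^+ 2 / b.
  by field; rewrite gt_eqF.
by rewrite ler_pdivrMr// mulrC.
Qed.

End moments.

(** * Finiteness of the lifespan *)

Unset Implicit Arguments.

Theorem theoremV1 (R : realType) (A gamma tau zeta T0 : R)
    (rho : R -> 'rV[R]_3 -> R) (v : R -> 'rV[R]_3 -> 'rV[R]_3)
    (Pi : R -> 'rV[R]_3 -> R)
    (rho0 : 'rV[R]_3 -> R) (R0 rhobar : R)
    (hA : 0 < A) (hgamma : 1 < gamma) (htau : 0 < tau) (hzeta : 0 < zeta)
    (hT0 : 0 < T0) (hsol : is_C1_solution A gamma tau zeta T0 rho v Pi)
    (hrho0 : forall x, rho 0 x = rho0 x) (hrho0_gt0 : forall x, 0 < rho0 x)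
    (hR0 : 0 < R0) (hrhobar : 0 < rhobar)
    (hext : forall x, R0 <= enorm x ->
       [/\ rho0 x = rhobar, v 0 x = 0 & Pi 0 x = 0])
    (hM : 0 <= DeltaM rhobar rho 0)
    (hF : 16 * pi / 3 * cvbar A gamma tau zeta rhobar * R0 ^+ 4
            * sup (range rho0) < Fmom rho v 0)
    (hG : 0 <= Gint Pi 0) :
  lifespan A gamma tau zeta rho0 (v 0) (Pi 0) \is a fin_num.
Proof.
(* Makes [sup] a true upper bound: the initial density is bounded on a cube by compactness and
   constant outside it. *)
have hub : has_ubound (range rho0).
  have [hr _ _ _] := hsol.
  have [M M0 hM'] := slab_bounded R0 (C1_slab_continuous hT0 hr).
  exists (M + rhobar) => _ [x _ <-].
  have [xR|Rx] := leP `|x| R0.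
    have := hM' 0 x; rewrite lexx ltW// => /(_ isT xR).
    by rewrite hrho0 => /(le_trans (ler_norm _)) h; rewrite (le_trans h)// lerDl ltW.
  have [-> _ _] := hext x (le_trans (ltW Rx) (le_norm_enorm x)).
  by rewrite lerDr.
set m := sup (range rho0) in hF.
pose c := cvbar A gamma tau zeta rhobar.
pose F0 := Fmom rho v 0.
(* [B] is computed from the constants and the data at time 0 alone, so it bounds the existence time
   of every solution with these data. *)
pose B := Num.max 1 (4 * (4 / 3 * pi * m) * c
    * ((4 * (4 / 3 * pi * m) * c * R0 ^+ 4)^-1 - F0^-1))^-1 / c.
have bound T : [set T : R | 0 < T /\ exists rho v' Pi', is_C1_solution A gamma tau zeta T rho v' Pi' /\
      forall x, [/\ rho 0 x = rho0 x, v' 0 x = v 0 x & Pi' 0 x = Pi 0 x]] T -> T <= B.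
  move=> [T_gt0 [rho' [v' [Pi' [sol' init]]]]].
  have e1 : rho' 0 = rho 0 by apply/funext => x; rewrite hrho0; have [] := init x.
  have e2 : v' 0 = v 0 by apply/funext => x; have [] := init x.
  have e3 : Pi' 0 = Pi 0 by apply/funext => x; have [] := init x.
  have eF : Fmom rho' v' 0 = F0 by rewrite /F0 /Fmom e1 e2.
  rewrite /B -eF; apply: (@existence_time_bound _ _ _ _ _ _ _ _ m rho' v' Pi') => //.
  - by move=> x /hext; rewrite -hrho0 e1 e2 e3.
  - by move=> x; rewrite e1 hrho0; apply: ub_le_sup => //; exists x.
  - by rewrite /DeltaM e1.
  - by rewrite /Gint e3.
  - rewrite eF; apply: le_lt_trans hF.
    by rewrite le_eqVlt; apply/orP; left; apply/eqP; rewrite /c; field.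
(* The given solution on [0, T0] excludes -oo, and [B] excludes +oo. *)
apply: fin_real; apply/andP; split.
- apply: (lt_le_trans (ltNyr T0)); apply: ereal_sup_ubound.
  by exists T0 => //; split => //; exists rho, v, Pi.
- apply: le_lt_trans (ltry B); apply: ge_ereal_sup => _ [T /bound TB <-].
  by rewrite lee_fin.
Qed.
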